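(* Suppose the collision kernel satisfies the Assumption stated in the context (with constants $b_0>0$, $\eta\ge 1$, and the function $k$, and $q_1$ defined there). Let $F_0\in\mathcal B_1^+(\mathbb R_{\ge0})$ have mass $N=N(F_0)>0$ and energy $E=E(F_0)>0$, and let $\{F_t\}_{t\ge0}$ be a conservative measure-valued isotropic solution of the Bose–Einstein Boltzmann equation on $[0,\infty)$ with initial datum $F_0$. Then $$F_t(\{0\})\le e^{ct}F_0(\{0\})\qquad\forall\,t\ge0,\qquad c=8^{2+\eta}b_0^2(1+q_1)N^2 .$$ In particular, if $F_0(\{0\})=0$ then $F_t(\{0\})=0$ for all $t\ge0$.
   Context: Notation. $\mathcal B_k^+(\mathbb R_{\ge0})$ ($k\ge0$) is the set of nonnegative Borel measures $F$ on $\mathbb R_{\ge0}=[0,\infty)$ with $\int(1+x)^k\,dF(x)<\infty$. For $p\in\mathbb R$, $M_p(F)=\int_{\mathbb R_{\ge0}}x^p\,dF(x)$ (with $0^p=\infty$ for $p<0$ and $\infty\cdot0=0$); $N(F)=M_0(F)$, $E(F)=M_1(F)$. $C^{1,1}_b(\mathbb R_{\ge0})$ is the set of $\varphi\in C^1_b(\mathbb R_{\ge0})$ whose derivative is Lipschitz. Kernel. Let $\hat\phi:[0,\infty)\to\mathbb R$ be continuous and bounded and $\Phi(r,\rho)=(\hat\phi(r)+\hat\phi(\rho))^2$. For $x,y,z\ge0$ let $x_*=(y+z-x)_+$. If $x_*xyz>0$, $$W(x,y,z)=\frac{1}{4\pi\sqrt{xyz}}\int_{|\sqrt x-\sqrt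 y|\vee|\sqrt{x_*}-\sqrt z|}^{(\sqrt x+\sqrt y)\wedge(\sqrt{x_*}+\sqrt z)}ds\int_0^{2\pi}\Phi(\sqrt2\,s,\sqrt2\,Y_* )\,d\theta,$$ where $Y_*=\big|\sqrt{(z-\frac{(x-y+s^2)^2}{4s^2})_+}+e^{i\theta}\sqrt{(x-\frac{(x-y+s^2)^2}{4s^2})_+}\big|$ for $s>0$ and $Y_*=0$ for $s=0$. Otherwise $W(0,y,z)=\Phi(\sqrt{2y},\sqrt{2z})/\sqrt{yz}$ for $y,z>0$; $W(x,0,z)=\Phi(\sqrt{2x},\sqrt{2(z-x)})/\sqrt{xz}$ for $z>x>0$; $W(x,y,0)=\Phi(\sqrt{2(y-x)},\sqrt{2x})/\sqrt{xy}$ for $y>x>0$; and $W=0$ in all other cases. For a function $\varphi$ put $\Delta\varphi(x,y,z)=\varphi(x)+\varphi(x_* )-\varphi(y)-\varphi(z)$, $\mathcal K[\varphi](x,y,z)=W(x,y,z)\Delta\varphi(x,y,z)$, and $\mathcal J[\varphi](y,z)=\frac12\int_0^{y+z}\mathcal K[\varphi](x,y,z)\sqrt x\,dx$. Solutions. Given $F_0\in\mathcal B_1^+(\mathbb R_{\ge0})$, a family $\{F_t\}_{t\ge0}\subset\mathcal B_1^+(\mathbb R_{\ge0})$ is a conservative measure-valued isotropic solution on $[0,\infty)$ with initial datum $F_0$ if (i) $N(F_t)=N(F_0)$, $E(F_t)=E(F_0)$ for all $t\ge0$; (ii) for every $\varphi\in C^{1,1}_b(\mathbb R_{\ge0})$,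 $t\mapsto\int\varphi\,dF_t$ belongs to $C^1([0,\infty))$; (iii) for every such $\varphi$ and all $t\ge0$, $\frac{d}{dt}\int\varphi\,dF_t=\int_{\mathbb R_{\ge0}^2}\mathcal J[\varphi](y,z)\,dF_t(y)dF_t(z)+\int_{\mathbb R_{\ge0}^3}\mathcal K[\varphi](x,y,z)\,dF_t(x)dF_t(y)dF_t(z)$. Assumption. $\hat\phi$ is continuous on $[0,\infty)$, there are constants $b_0>0$, $\eta\ge1$ with $0\le\hat\phi(r)\le b_0\frac{r^\eta}{1+r^\eta}$ for all $r\ge0$, and there is $k\in C^1([1,\sqrt2])$ with $k(1)=1$ such that $\hat\phi(ar)\le k(a)\hat\phi(r)$ for all $r>0$ and all $1<a\le\sqrt2$. Set $q_1=\max_{x\in[1,\sqrt2]}\max\{2k(x)k'(x),0\}$. *)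

(* Defs.v *)
From HB Require Import structures.
From mathcomp Require Import all_boot all_order all_algebra.
From mathcomp Require Import all_classical all_reals all_analysis.
Set Implicit Arguments. Unset Strict Implicit. Unset Printing Implicit Defensive.
Import Order.TTheory GRing.Theory Num.Theory.
Import numFieldNormedType.Exports.
Local Open Scope classical_set_scope.
Local Open Scope ring_scope.

Section Defs.
Variable R : realType.

Definition Rpos : set R := `[0, +oo[%classic.

Definition deriv_within (A : set R) (f : R -> R) (x l : R) : Prop :=
  (fun h : R => h^-1 * (f (x + h) - f x)) @ within (fun h => A (x + h)) (0 : R)^' --> l.

Definition C1_on (A : set R) (f : R -> R) : Prop :=
  exists df : R -> R, (forall x, A x -> deriv_within A f x (df x)) /\
                      {within A, continuous df}.

Definition C11b (phi : R -> R) : Prop :=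
  exists dphi : R -> R,
    (forall x, 0 <= x -> deriv_within Rpos phi x (dphi x)) /\
    (exists M : R, forall x, 0 <= x -> `|phi x| <= M /\ `|dphi x| <= M) /\
    (exists L : R, forall x y, 0 <= x -> 0 <= y ->
        `|dphi x - dphi y| <= L * `|x - y|).

(* measures on R_{>=0}: Borel measures on R carrying no mass on ]-oo,0[ *)
Definition in_B1 (F : {measure set R -> \bar R}) : Prop :=
  F `]-oo, 0[%classic = 0%E /\
  (\int[F]_(x in Rpos) (1 + x)%:E < +oo)%E.

Definition Nmass (F : {measure set R -> \bar R}) : \bar R := F Rpos.
Definition Energy (F : {measure set R -> \bar R}) : \bar R :=
  (\int[F]_(x in Rpos) x%:E)%E.

Definition PhiK (hphi : R -> R) (r rho : R) : R := (hphi r + hphi rho) ^+ 2.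

Definition xstar (x y z : R) : R := Num.max (y + z - x) 0.

Definition posp (a : R) : R := Num.max a 0.

(* Y_* (s, theta) = | sqrt((z - w)_+) + e^{i theta} sqrt((x - w)_+) |,
   w = (x - y + s^2)^2 / (4 s^2), for s > 0; Y_* = 0 for s = 0 *)
Definition Ystar (x y z s th : R) : R :=
  if s == 0 then 0 else
  let w := (x - y + s ^+ 2) ^+ 2 / (4 * s ^+ 2) in
  let A := Num.sqrt (posp (z - w)) in
  let B := Num.sqrt (posp (x - w)) in
  Num.sqrt ((A + B * cos th) ^+ 2 + (B * sin th) ^+ 2).

Definition Wk (hphi : R -> R) (x y z : R) : R :=
  let xs := xstar x y z in
  if 0 < xs * x * y * z then
    let lo := Num.max `|Num.sqrt x - Num.sqrt y| `|Num.sqrt xs - Num.sqrt z| in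
    let hi := Num.min (Num.sqrt x + Num.sqrt y) (Num.sqrt xs + Num.sqrt z) in
    (4 * pi * Num.sqrt (x * y * z))^-1 *
      Rintegral lebesgue_measure `[lo, hi]%classic (fun s =>
        Rintegral lebesgue_measure `[0, 2 * pi]%classic (fun th =>
          PhiK hphi (Num.sqrt 2 * s) (Num.sqrt 2 * Ystar x y z s th)))
  else if (x == 0) && (0 < y) && (0 < z) then
    PhiK hphi (Num.sqrt (2 * y)) (Num.sqrt (2 * z)) / Num.sqrt (y * z)
  else if (y == 0) && (0 < x) && (x < z) then
    PhiK hphi (Num.sqrt (2 * x)) (Num.sqrt (2 * (z - x))) / Num.sqrt (x * z)
  else if (z == 0) && (0 < x) && (x < y) then
    PhiK hphi (Num.sqrt (2 * (y - x))) (Num.sqrt (2 * x)) / Num.sqrt (x * y)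
  else 0.

Definition Delta (phi : R -> R) (x y z : R) : R :=
  phi x + phi (xstar x y z) - phi y - phi z.

Definition Kk (hphi phi : R -> R) (x y z : R) : R :=
  Wk hphi x y z * Delta phi x y z.

Definition Jk (hphi phi : R -> R) (y z : R) : \bar R :=
  let I : set R := `[0, y + z]%classic in
  ((2^-1)%:E * \int[lebesgue_measure]_(x in I)
                  (Kk hphi phi x y z * Num.sqrt x)%:E)%E.

Definition collision_rhs (hphi phi : R -> R) (G : {measure set R -> \bar R})
  : \bar R :=
  (\int[G \x G]_(p in Rpos `*` Rpos) Jk hphi phi p.1 p.2 +
   \int[(G \x G) \x G]_(p in (Rpos `*` Rpos) `*` Rpos)
       (Kk hphi phi p.1.1 p.1.2 p.2)%:E)%E.

Definition pairing (phi : R -> R) (G : {measure set R -> \bar R}) : R :=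
  fine (\int[G]_(x in Rpos) (phi x)%:E)%E.

Definition cons_mv_solution (hphi : R -> R) (F0 : {measure set R -> \bar R})
    (F : R -> {measure set R -> \bar R}) : Prop :=
  F 0 = F0 /\
  (forall t, 0 <= t -> in_B1 (F t)) /\
  (forall t, 0 <= t -> Nmass (F t) = Nmass F0 /\ Energy (F t) = Energy F0) /\
  (forall phi, C11b phi ->
     exists dg : R -> R,
       (forall t, 0 <= t -> deriv_within Rpos (fun s => pairing phi (F s)) t (dg t)) /\
       {within Rpos, continuous dg} /\
       (forall t, 0 <= t -> (dg t)%:E = collision_rhs hphi phi (F t))).

End Defs.

(* Main.v *)
Require Import Defs.
From HB Require Import structures.
From mathcomp Require Import all_boot all_order all_algebra.
From mathcomp Require Import all_classical all_reals all_analysis.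
From mathcomp Require Import measurable_realfun ring lra.
Set Implicit Arguments. Unset Strict Implicit. Unset Printing Implicit Defensive.
Import Order.TTheory GRing.Theory Num.Theory.
Import numFieldNormedType.Exports.
Local Open Scope classical_set_scope.
Local Open Scope ring_scope.

(** Test the weak equation with [phi_m x = max(1 - m x, 0)^2], which is convex and
    nonincreasing and tends to the indicator of [{0}].  The quadratic term
    contributes [O(1/m)], because [W(x,y,z) sqrt x] is bounded and [phi_m] lives
    on [[0, 1/m]].  The cubic integrand is symmetrised over the six permutations
    of a triple [a <= b <= c].
    - The gain at [x = a] is paired with the loss at [x = b].  When [4 b <= c],
      [W(a,..)] exceeds [W(b,..)] by a factor at most [1 + O((1 + q1) (b - a)/(c - b))],
      and by convexity the test function differences also agree up to
      [phi_m a (b - a)/(c - b)].  When [c < 4 b], [W(a,..)] itself is bounded.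
      Either way the pair is at most [40 b0^2 (1 + q1) phi_m a].
    - At [x = c] the kernel is at most [O(sqrt (x_* / a))] with [x_* <= 1/m] on
      the support, which vanishes in the limit since [W = 0] when [a = 0].
    Hence [u_m(t) = \int phi_m dF_t] satisfies [u_m' <= c u_m + e_m] with [e_m]
    bounded and tending to [0] pointwise in [t].  As [t |-> e_m t] need not be
    measurable, Gronwall is run with the continuous function
    [max(u_m' - c u_m, 0)], which lies below [e_m]. *)

(** When [b] is much smaller than [c], the kernel on a triple [a <= b <= c] is only bounded by a
    multiple of [b0^2 sqrt (c / b)], so a gain term alone is not controlled by [phi_m a]. Gain and
    loss must be subtracted before estimating: what is left of a pair carries a factor of order
    [(b - a) / (c - b)], at most [b / (c - b)], and [sqrt (c / b) * b / (c - b)] is bounded once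
    [4 b <= c]. Comparing the kernels takes two mechanisms. With [c] as last argument, both
    integrals run over the same [s] and only [Ystar] changes; with [c] in the middle, the ranges of
    [s] differ and a change of variable makes them equal. Either way the arguments of [hphi] are
    stretched by at most [(c - a) / (c - b)], which is where [k] and [q1] enter. The constant: two
    pairs per triple cost [80 b0^2 (1 + q1)] times a sum over three coordinates, averaging over six
    permutations gives [80 * 3 / 6 = 40], and [40 <= 8^2 <= 8^(2 + eta)]. *)

(** * The test function: convexity and regularity *)

Section test_function.
Variable R : realType.
Implicit Types (m x a b c u : R).

(** The square makes the derivative Lipschitz, as [C11b] requires; the truncated affine function
    alone has a kink at [1 / m]. *)
Definition testf m x : R := Num.max (1 - m * x) 0 ^+ 2.

Lemma testf_ge0 m x : 0 <= testf m x.
Proof. exact: sqr_ge0. Qed.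

Lemma testf_le1 m x : 0 <= m -> 0 <= x -> testf m x <= 1.
Proof.
move=> m0 x0; rewrite /testf -[leRHS](expr1n _ 2).
rewrite ler_sqr ?nnegrE ?le_max ?lexx ?orbT// ge_max ler01 andbT.
by rewrite gerBl mulr_ge0.
Qed.

Lemma testf_nincr m x y : 0 <= m -> x <= y -> testf m y <= testf m x.
Proof.
move=> m0 xy; have mxy : m * x <= m * y by rewrite ler_wpM2l.
rewrite /testf; case: (leP (1 - m * x) 0) => h1; case: (leP (1 - m * y) 0) => h2;
  rewrite ?expr0n//=; [lra|exact: sqr_ge0|nra].
Qed.

Lemma testf_eq0 m x : 1 <= m * x -> testf m x = 0.
Proof. by move=> mx; rewrite /testf max_r ?expr0n// subr_le0. Qed.

Lemma testf_tangent m x u :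
  testf m x - 2 * m * Num.max (1 - m * x) 0 * (u - x) <= testf m u.
Proof.
rewrite /testf; case: (leP (1 - m * x) 0) => h1; case: (leP (1 - m * u) 0) => h2.
- by rewrite expr0n /=; lra.
- by rewrite expr0n /= mulr0 mul0r subr0 sqr_ge0.
- by rewrite expr0n /=; nra.
- have := sqr_ge0 (m * (u - x)); nra.
Qed.

(** Weighted sum of the tangent inequalities at [x], evaluated at the two end points; the slope
    terms cancel. Multiplying by [c - a] avoids a separate case [a = c]. *)
Lemma testf_chord m a x c : a <= x <= c ->
  (c - a) * testf m x <= (c - x) * testf m a + (x - a) * testf m c.
Proof.
move=> /andP[ax xc].
have ha := testf_tangent m x a; have hc := testf_tangent m x c.
have h1 : 0 <= (c - x) * (testf m a -
    (testf m x - 2 * m * Num.max (1 - m * x) 0 * (a - x))).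
  by rewrite mulr_ge0 ?subr_ge0.
have h2 : 0 <= (x - a) * (testf m c -
    (testf m x - 2 * m * Num.max (1 - m * x) 0 * (c - x))).
  by rewrite mulr_ge0 ?subr_ge0.
rewrite -subr_ge0 (_ : _ - _ = (c - x) * (testf m a -
    (testf m x - 2 * m * Num.max (1 - m * x) 0 * (a - x))) +
  (x - a) * (testf m c -
    (testf m x - 2 * m * Num.max (1 - m * x) 0 * (c - x)))); last by ring.
exact: addr_ge0.
Qed.

(** The points [b] and [a + c - b] are symmetric about the midpoint of [[a, c]], so the weights of
    the two chord inequalities add up to [c - a] at each end. *)
Lemma testf_majorize m a b c : a <= b <= c ->
  testf m b + testf m (a + c - b) <= testf m a + testf m c.
Proof.
move=> /andP[ab bc]; have [ca|ac] := leP c a.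
  have -> : b = a by lra.
  by have -> : a + c - a = c by ring.
rewrite -(ler_pM2l (x := c - a)) ?subr_gt0//.
have h1 := @testf_chord m a b c; rewrite ab bc in h1.
have h2 := @testf_chord m a (a + c - b) c.
have {}h1 := h1 isT; have {}h2 := h2 ltac:(lra).
rewrite mulrDr; apply: (le_trans (lerD h1 h2)); lra.
Qed.

(** The chord inequality at [a + c - b], whose distance to [c] is [b - a]. This supplies the small
    factor in the sum of the test function differences of a gain and a loss. *)
Lemma testf_slope m a b c : a <= b <= c -> 0 <= m ->
  (c - a) * (testf m (a + c - b) - testf m c) <= (b - a) * testf m a.
Proof.
move=> /andP[ab bc] m0.
have h2 := @testf_chord m a (a + c - b) c ltac:(lra).
have h3 : 0 <= (b - a) * testf m c by rewrite mulr_ge0 ?testf_ge0 ?subr_ge0.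
nra.
Qed.

Lemma testf_continuous m : continuous (testf m).
Proof.
move=> x; rewrite /testf.
apply: (@cvg_comp _ _ _ (fun x => Num.max (1 - m * x) 0) (fun z => z ^+ 2)); last first.
  exact: exprn_continuous.
apply: (@cvg_comp _ _ _ (fun x => 1 - m * x) (fun z => Num.max z 0)).
  by apply: cvgB; [exact: cvg_cst|apply: cvgM; [exact: cvg_cst|exact: cvg_id]].
have : continuous (fun z : R => Num.max z 0).
  by move=> z; apply: continuous_max; [exact: cvg_id|exact: cvg_cst].
by apply.
Qed.

(** A second order Taylor bound that holds across [x = 1 / m], where the second derivative jumps;
    the lower half is the tangent inequality. *)
Lemma testf_quad m x h :
  `|testf m (x + h) - testf m x + 2 * m * Num.max (1 - m * x) 0 * h| <=
  m ^+ 2 * h ^+ 2.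
Proof.
have t1 := testf_tangent m x (x + h).
rewrite ger0_norm; last by nra.
rewrite /testf; case: (leP (1 - m * x) 0) => h1;
  case: (leP (1 - m * (x + h)) 0) => h2.
- by rewrite expr0n/= ; have := sqr_ge0 (m * h); nra.
- by rewrite expr0n /=; nra.
- have hh : 0 <= (m * h) ^+ 2 - (1 - m * x) ^+ 2 + (1 - m * x) ^+ 2 by nra.
  rewrite expr0n /=.
  have : 0 <= (m * h - (1 - m * x)) ^+ 2 by exact: sqr_ge0.
  nra.
- nra.
Qed.

Lemma testf_C11b m : 0 <= m -> C11b (testf m).
Proof.
move=> m0; exists (fun x => - (2 * m * Num.max (1 - m * x) 0)); split; last split.
- move=> x x0; rewrite /deriv_within.
  apply: cvg_within_filter.
  apply/cvgrPdist_le => e e0.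
  have m1 : 0 < m ^+ 2 + 1 by rewrite ltr_wpDl ?sqr_ge0.
  near=> h.
  have h0 : h != 0 by near: h; exact: nbhs_dnbhs_neq.
  have -> : - (2 * m * Num.max (1 - m * x) 0) -
     h^-1 * (testf m (x + h) - testf m x) =
     - (h^-1 * (testf m (x + h) - testf m x + 2 * m * Num.max (1 - m * x) 0 * h)).
    by field.
  rewrite normrN normrM; apply: (@le_trans _ _ (`|h^-1| * (m ^+ 2 * h ^+ 2))).
    by rewrite ler_wpM2l// testf_quad.
  rewrite normfV -(real_normK (num_real h)).
  have -> : `|h|^-1 * (m ^+ 2 * `|h| ^+ 2) = m ^+ 2 * `|h|.
    by field; rewrite normr_eq0.
  apply: (@le_trans _ _ ((m ^+ 2 + 1) * `|h|)).
    by rewrite ler_wpM2r// lerDl.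
  rewrite mulrC -ler_pdivlMr//.
  near: h; exact/dnbhs0_le/divr_gt0.
- exists (2 * m + 1) => x x0; split.
    rewrite ger0_norm ?testf_ge0// (le_trans (testf_le1 _ x0))//; lra.
  rewrite normrN ger0_norm; last by rewrite !mulr_ge0// le_max lexx orbT.
  have : Num.max (1 - m * x) 0 <= 1 by rewrite ge_max ler01 andbT gerBl mulr_ge0.
  by nra.
- exists (2 * m ^+ 2) => x y x0 y0.
  rewrite opprK addrC -mulrBr normrM ger0_norm; last by rewrite mulr_ge0.
  have -> : 2 * m ^+ 2 * `|x - y| = 2 * m * (m * `|x - y|) by ring.
  rewrite ler_wpM2l ?mulr_ge0//.
  have -> : m * `|x - y| = `|m * x - m * y| by rewrite -mulrBr normrM (ger0_norm m0).
  have [hx|hx] := leP (1 - m * x) 0; have [hy|hy] := leP (1 - m * y) 0.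
  + by rewrite subrr normr0.
  + rewrite ler_norml; have := ler_norm (m * x - m * y); lra.
  + rewrite ler_norml; have := ler_norm (-(m * x - m * y)); rewrite normrN; lra.
  + by rewrite (_ : 1 - m * y - (1 - m * x) = m * x - m * y)//; ring.
Unshelve. all: by end_near.
Qed.

End test_function.

(** * Measurability of the kernel, for a profile continuous on the whole line *)

Section measurability.
Context {R : realType}.

Lemma measurable_fun_inv d (T : measurableType d) (f : T -> R) :
  measurable_fun setT f -> measurable_fun setT (fun t => (f t)^-1).
Proof.
(* Since [powR] is used as an inverse on nonnegative numbers only, [f] is squared first; where [f]
   vanishes, the outer factor restores the convention [0^-1 = 0]. *)
move=> mf; rewrite (_ : (fun _ => _) = fun t => f t * ((f t ^+ 2) `^ (-1))).
  apply: measurable_funM => //.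
  by apply: (measurableT_comp (@measurable_powR R (-1))); exact: measurable_funX.
apply/funext => t; rewrite powR_inv1 ?sqr_ge0//.
have [->|f0] := eqVneq (f t) 0; first by rewrite mul0r invr0.
by field.
Qed.

Lemma measurable_fun_sqrt d (T : measurableType d) (f : T -> R) :
  measurable_fun setT f -> measurable_fun setT (fun t => Num.sqrt (f t)).
Proof.
move=> mf; apply: measurableT_comp => //.
by apply: continuous_measurable_fun; exact: sqrt_continuous.
Qed.

Lemma measurable_fun_normr d (T : measurableType d) (f : T -> R) :
  measurable_fun setT f -> measurable_fun setT (fun t => `|f t|).
Proof. by move=> mf; exact: measurableT_comp. Qed.

Variable hphi : R -> R.
Hypothesis chphi : continuous hphi.

Ltac meas := repeat (first [assumption | exact: measurable_cst
  | apply: measurable_fun_sqrt | apply: measurable_fun_normr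
  | apply: measurable_fun_inv
  | apply: measurable_funX
  | apply: measurable_fun_ifT | apply: measurable_fun_eqr
  | apply: measurable_fun_ltr | apply: measurable_fun_ler | apply: measurable_and
  | apply: measurable_funB | apply: measurable_funD | apply: measurable_funM
  | apply: measurable_maxr | apply: measurable_minr ]).

Lemma measurable_PhiK d (T : measurableType d) (f g : T -> R) :
  measurable_fun setT f -> measurable_fun setT g ->
  measurable_fun setT (fun t => PhiK hphi (f t) (g t)).
Proof.
move=> mf mg; have mh := continuous_measurable_fun chphi.
by rewrite /PhiK; meas; exact: measurableT_comp.
Qed.

Lemma measurable_Ystar d (T : measurableType d) (X Y Z S H : T -> R) :
  measurable_fun setT X -> measurable_fun setT Y -> measurable_fun setT Z ->
  measurable_fun setT S -> measurable_fun setT H ->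
  measurable_fun setT (fun t => Ystar (X t) (Y t) (Z t) (S t) (H t)).
Proof.
move=> mX mY mZ mS mH; rewrite /Ystar /posp; meas.
- by apply: measurableT_comp => //; apply: continuous_measurable_fun; exact: continuous_cos.
- by apply: measurableT_comp => //; apply: continuous_measurable_fun; exact: continuous_sin.
Qed.

Definition Psi (x y z s : R) : R :=
  Rintegral lebesgue_measure `[0, 2 * pi]%classic (fun th =>
    PhiK hphi (Num.sqrt 2 * s) (Num.sqrt 2 * Ystar x y z s th)).

(** The moving end points are absorbed into the integrand by extending it by zero; measurability in
    the parameter is then Tonelli's theorem. *)
Lemma measurable_Rintegral_itv d (T : measurableType d) (lo hi : T -> R)
    (f : T * R -> R) :
  measurable_fun setT lo -> measurable_fun setT hi -> measurable_fun setT f ->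
  (forall p, 0 <= f p) ->
  measurable_fun setT (fun t =>
    Rintegral lebesgue_measure `[lo t, hi t]%classic (fun s => f (t, s))).
Proof.
move=> mlo mhi mf f0.
pose g (p : T * R) : \bar R :=
  (if (lo p.1 <= p.2) && (p.2 <= hi p.1) then f p else 0)%:E.
have mg : measurable_fun setT g.
  apply/measurable_EFinP; apply: measurable_fun_ifT => //.
  apply: measurable_and; apply: measurable_fun_ler => //;
    exact: measurableT_comp.
have g0 p : (0 <= g p)%E by rewrite lee_fin; case: ifP.
have -> : (fun t => Rintegral lebesgue_measure `[lo t, hi t]%classic
    (fun s => f (t, s))) =
    fun t => fine (\int[lebesgue_measure]_s g (t, s))%E.
  apply/funext => t; rewrite /Rintegral integral_mkcond; congr fine.
  apply: eq_integral => s _; rewrite /g patchE mem_setE in_itv/=.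
  by case: ifP.
apply: measurableT_comp; first exact: fine_measurable.
exact: measurable_fun_fubini_tonelli_F.
Qed.

Lemma PhiK_ge0 r p : 0 <= PhiK hphi r p.
Proof. exact: sqr_ge0. Qed.

Lemma measurable_Psi d (T : measurableType d) (X Y Z S : T -> R) :
  measurable_fun setT X -> measurable_fun setT Y -> measurable_fun setT Z ->
  measurable_fun setT S ->
  measurable_fun setT (fun t => Psi (X t) (Y t) (Z t) (S t)).
Proof.
move=> mX mY mZ mS; pose f (p : T * R) := PhiK hphi (Num.sqrt 2 * S p.1)
  (Num.sqrt 2 * Ystar (X p.1) (Y p.1) (Z p.1) (S p.1) p.2).
apply: (@measurable_Rintegral_itv _ T (cst 0) (cst (2 * pi)) f) => //.
- apply: measurable_PhiK; apply: measurable_funM => //.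
    exact: (measurableT_comp mS).
  apply: measurable_Ystar => //; apply: measurableT_comp => //.
- by move=> p; exact: PhiK_ge0.
Qed.

Lemma Psi_ge0 x y z s : 0 <= Psi x y z s.
Proof. by apply: Rintegral_ge0 => th _; exact: PhiK_ge0. Qed.

Lemma measurable_Wk d (T : measurableType d) (X Y Z : T -> R) :
  measurable_fun setT X -> measurable_fun setT Y -> measurable_fun setT Z ->
  measurable_fun setT (fun t => Wk hphi (X t) (Y t) (Z t)).
Proof.
move=> mX mY mZ.
have mxs : measurable_fun setT (fun t => xstar (X t) (Y t) (Z t)).
  by rewrite /xstar; meas.
rewrite /Wk /=; meas; try (apply: measurable_PhiK; meas).
apply: (@measurable_Rintegral_itv _ T _ _
  (fun p => Psi (X p.1) (Y p.1) (Z p.1) p.2)); meas.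
- apply: measurable_Psi => //; exact: measurableT_comp.
- by move=> p; exact: Psi_ge0.
all: by apply: measurableT_comp; [exact: continuous_measurable_fun|meas].
Qed.

End measurability.

(** * Integrals of bounded functions over compact intervals *)

Section itv_Rintegral.
Context {R : realType}.
Notation mu := (@lebesgue_measure R).

Lemma lebesgue_measure_itvcc (a b : R) :
  mu `[a, b]%classic = (if a < b then b - a else 0)%:E.
Proof. by rewrite lebesgue_measure_itv/= lte_fin; case: ifP. Qed.

Lemma bounded_itv_integrable (f : R -> R) (M a b : R) :
  measurable_fun setT f -> (forall x, 0 <= f x <= M) ->
  mu.-integrable `[a, b] (EFin \o f).
Proof.
move=> mf fM; apply: measurable_bounded_integrable => //.
- by rewrite [X in (X < _)%E]lebesgue_measure_itvcc ltry.
- exact: measurable_funTS.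
- exists M; split; first exact: num_real.
  by move=> x Mx y _ /=; have /andP[f0 f1] := fM y; rewrite ger0_norm// (le_trans f1)// ltW.
Qed.

(** The separate bound [l >= 0] on the length lets the estimate cover an empty interval as well. *)
Lemma Rintegral_itv_le (f : R -> R) (S M a b l : R) :
  measurable_fun setT f -> (forall x, 0 <= f x <= M) ->
  0 <= S -> (forall x, a <= x <= b -> f x <= S) -> 0 <= l -> b - a <= l ->
  Rintegral mu `[a, b]%classic f <= S * l.
Proof.
move=> mf fM S0 fS l0 bal.
apply: (@le_trans _ _ (Rintegral mu `[a, b]%classic (cst S))).
  apply: le_Rintegral => //; first exact: bounded_itv_integrable fM.
    apply: (@bounded_itv_integrable _ S) => //.
    by move=> x; rewrite S0 lexx.
rewrite Rintegral_cst// ler_wpM2l// [X in fine X]lebesgue_measure_itvcc/=.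
by case: ifP.
Qed.

End itv_Rintegral.

(** * Pointwise upper bounds for the kernel *)

Section kernel_bounds.
Context {R : realType}.
Variables (hphi : R -> R) (b0 : R).
Hypothesis chphi : continuous hphi.
Hypothesis hphi_ge0 : forall r, 0 <= hphi r.
Hypothesis hphi_le : forall r, hphi r <= b0.
Hypothesis hphi_ler : forall r, 0 <= r -> hphi r <= b0 * r.
Notation mu := (@lebesgue_measure R).

Lemma b0_ge0 : 0 <= b0.
Proof. exact: le_trans (hphi_ge0 0) (hphi_le 0). Qed.

Lemma PhiK_le r p : PhiK hphi r p <= 4 * b0 ^+ 2.
Proof.
have := hphi_ge0 r; have := hphi_ge0 p; have := hphi_le r; have := hphi_le p.
by rewrite /PhiK; nra.
Qed.

Lemma PhiK_le_sqr r p : 0 <= r -> 0 <= p ->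
  PhiK hphi r p <= 2 * b0 ^+ 2 * (r ^+ 2 + p ^+ 2).
Proof.
move=> r0 p0.
have hr : hphi r ^+ 2 <= (b0 * r) ^+ 2.
  by rewrite ler_sqr ?nnegrE// ?hphi_ler// mulr_ge0// b0_ge0.
have hp : hphi p ^+ 2 <= (b0 * p) ^+ 2.
  by rewrite ler_sqr ?nnegrE// ?hphi_ler// mulr_ge0// b0_ge0.
have := sqr_ge0 (hphi r - hphi p); rewrite /PhiK; nra.
Qed.

(** In each square one factor is bounded by [b0] and the other by [b0 * r]. The linear bound has the
    homogeneity that makes [W * sqrt x] bounded; the quadratic one serves the cubic term. *)
Lemma PhiK_le_lin r p : 0 <= r -> 0 <= p ->
  PhiK hphi r p <= 2 * b0 ^+ 2 * (r + p).
Proof.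
move=> r0 p0.
have hr : hphi r ^+ 2 <= b0 * (b0 * r) by rewrite expr2 ler_pM// hphi_ler.
have hp : hphi p ^+ 2 <= b0 * (b0 * p) by rewrite expr2 ler_pM// hphi_ler.
have := sqr_ge0 (hphi r - hphi p); rewrite /PhiK; nra.
Qed.

Lemma Ystar_ge0 (x y z s th : R) : 0 <= Ystar x y z s th.
Proof. by rewrite /Ystar; case: ifP => // _; exact: sqrtr_ge0. Qed.

Lemma norm_add_polar (A B th : R) :
  (A + B * cos th) ^+ 2 + (B * sin th) ^+ 2 =
  A ^+ 2 + B ^+ 2 + 2 * A * B * cos th.
Proof.
rewrite [in X in _ = _ + X + _](_ : B ^+ 2 = B ^+ 2 * (cos th ^+ 2 + sin th ^+ 2)).
  by ring.
by rewrite cos2Dsin2 mulr1.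
Qed.

Lemma Ystar_le (x y z s th : R) : Ystar x y z s th <= Num.sqrt x + Num.sqrt z.
Proof.
rewrite /Ystar; case: ifP => [_|_]; first by rewrite addr_ge0 ?sqrtr_ge0.
set w := _ / _; set A := Num.sqrt (posp (z - w)); set B := Num.sqrt (posp (x - w)).
have w0 : 0 <= w.
  by apply: divr_ge0; [exact: sqr_ge0|apply: mulr_ge0 => //; exact: sqr_ge0].
have hA : A <= Num.sqrt z.
  rewrite /A /posp; case: (leP (z - w) 0) => h; first by rewrite sqrtr0 sqrtr_ge0.
  by rewrite ler_wsqrtr// gerBl.
have hB : B <= Num.sqrt x.
  rewrite /B /posp; case: (leP (x - w) 0) => h; first by rewrite sqrtr0 sqrtr_ge0.
  by rewrite ler_wsqrtr// gerBl.
have A0 : 0 <= A by exact: sqrtr_ge0.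
have B0 : 0 <= B by exact: sqrtr_ge0.
apply: (@le_trans _ _ (A + B)); last by lra.
rewrite -[leRHS]ger0_norm ?addr_ge0// -sqrtr_sqr ler_wsqrtr// norm_add_polar.
have : A * B * cos th <= A * B by rewrite ler_piMr ?mulr_ge0// cos_le1.
nra.
Qed.

Lemma Psi_le (x y z s S : R) : 0 <= S ->
  (forall th, PhiK hphi (Num.sqrt 2 * s) (Num.sqrt 2 * Ystar x y z s th) <= S) ->
  Psi hphi x y z s <= S * (2 * pi).
Proof.
move=> S0 hS; apply: (@Rintegral_itv_le _ _ S (4 * b0 ^+ 2)) => //.
- apply: measurable_PhiK => //; apply: measurable_funM => //.
  exact: measurable_Ystar.
- by move=> th; rewrite PhiK_ge0 PhiK_le.
- by rewrite mulr_ge0// pi_ge0.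
- by rewrite subr0.
Qed.

Lemma Psi_bounded (x y z s : R) :
  0 <= Psi hphi x y z s <= 4 * b0 ^+ 2 * (2 * pi).
Proof.
rewrite Psi_ge0/= Psi_le//; first by rewrite mulr_ge0// sqr_ge0.
by move=> th; exact: PhiK_le.
Qed.

Definition slo (x y z : R) := Num.max `|Num.sqrt x - Num.sqrt y|
  `|Num.sqrt (xstar x y z) - Num.sqrt z|.
Definition shi (x y z : R) := Num.min (Num.sqrt x + Num.sqrt y)
  (Num.sqrt (xstar x y z) + Num.sqrt z).

Lemma WkE (x y z : R) : 0 < x -> 0 < y -> 0 < z -> 0 < xstar x y z ->
  Wk hphi x y z = (4 * pi * Num.sqrt (x * y * z))^-1 *
    Rintegral mu `[slo x y z, shi x y z]%classic (Psi hphi x y z).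
Proof.
move=> x0 y0 z0 xs0; rewrite /Wk /= ifT//.
by rewrite !mulr_gt0.
Qed.

Lemma Wk_eq0 (x y z : R) : 0 < x -> 0 < y -> 0 < z -> y + z <= x ->
  Wk hphi x y z = 0.
Proof.
move=> x0 y0 z0 xs0; rewrite /Wk /= /xstar max_r; last by rewrite subr_le0.
by rewrite !mul0r ltxx !gt_eqF.
Qed.

Lemma Wk_ge0 (x y z : R) : 0 <= Wk hphi x y z.
Proof.
rewrite /Wk /=; case: ifP => [_|_].
  rewrite mulr_ge0 ?invr_ge0 ?mulr_ge0 ?pi_ge0 ?sqrtr_ge0//.
  by apply: Rintegral_ge0 => s _; exact: Psi_ge0.
by repeat case: ifP => _ //; rewrite divr_ge0 ?sqrtr_ge0 ?PhiK_ge0.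
Qed.

(** The range of [s] is the intersection of two intervals of the form [[|p - q|, p + q]], and such
    an interval has length twice the smaller of [p] and [q]. *)
Lemma shi_slo (x y z : R) : forall L, L \in [:: Num.sqrt x; Num.sqrt y; Num.sqrt z;
  Num.sqrt (xstar x y z)] -> shi x y z - slo x y z <= 2 * L.
Proof.
rewrite /shi /slo; set p := Num.sqrt x; set q := Num.sqrt y.
set r := Num.sqrt z; set t := Num.sqrt _.
have h1 : Num.min (p + q) (t + r) <= p + q by rewrite ge_min lexx.
have h2 : Num.min (p + q) (t + r) <= t + r by rewrite ge_min lexx orbT.
have h3 : `|p - q| <= Num.max `|p - q| `|t - r| by rewrite le_max lexx.
have h4 : `|t - r| <= Num.max `|p - q| `|t - r| by rewrite le_max lexx orbT.
have := ler_norm (p - q); have := ler_norm (t - r).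
have := ler_norm (- (p - q)); have := ler_norm (- (t - r)); rewrite !normrN.
move=> a1 a2 a3 a4 L; rewrite !inE => /or4P[] /eqP ->; lra.
Qed.

(** The angle contributes [2 * pi] and the range of [s] at most [2 * L], which together cancel the
    [4 * pi] of the normalisation. The free choice of [L] allows one singular factor of the
    denominator to be cancelled. *)
Lemma Wk_bound (x y z S L : R) : 0 < x -> 0 < y -> 0 < z -> 0 < xstar x y z ->
  0 <= S -> L \in [:: Num.sqrt x; Num.sqrt y; Num.sqrt z; Num.sqrt (xstar x y z)] ->
  (forall s p, 0 <= s <= Num.sqrt x + Num.sqrt y ->
     0 <= p <= Num.sqrt x + Num.sqrt z ->
     PhiK hphi (Num.sqrt 2 * s) (Num.sqrt 2 * p) <= S) ->
  Wk hphi x y z <= L * S / Num.sqrt (x * y * z).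
Proof.
move=> x0 y0 z0 xs0 S0 HL hS; rewrite WkE//.
have L0 : 0 <= L.
  by move: HL; rewrite !inE => /or4P[] /eqP ->; exact: sqrtr_ge0.
have sq0 : 0 < Num.sqrt (x * y * z) by rewrite sqrtr_gt0 !mulr_gt0.
have -> : L * S / Num.sqrt (x * y * z) =
   (4 * pi * Num.sqrt (x * y * z))^-1 * (S * (2 * pi) * (2 * L)).
  move: (pi : R) (pi_gt0 R) => P P0.
  by field; rewrite !gt_eqF.
rewrite ler_wpM2l ?invr_ge0 ?mulr_ge0 ?pi_ge0 ?(ltW sq0)//.
apply: (@Rintegral_itv_le _ _ _ (4 * b0 ^+ 2 * (2 * pi))) => //.
- exact: measurable_Psi.
- by move=> s; exact: Psi_bounded.
- by rewrite !mulr_ge0// pi_ge0.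
- move=> s /andP[s1 s2]; apply: Psi_le => // th; apply: hS.
    apply/andP; split; first by rewrite (le_trans _ s1)// le_max normr_ge0.
    by rewrite (le_trans s2)// ge_min lexx.
  by rewrite Ystar_ge0 Ystar_le.
- by rewrite mulr_ge0.
- exact: shi_slo.
Qed.

Lemma Wk_le_sqr (x y z L : R) : 0 < x -> 0 < y -> 0 < z -> 0 < xstar x y z ->
  L \in [:: Num.sqrt x; Num.sqrt y; Num.sqrt z; Num.sqrt (xstar x y z)] ->
  Wk hphi x y z <= L * (8 * b0 ^+ 2 * (2 * x + y + z)) / Num.sqrt (x * y * z).
Proof.
move=> x0 y0 z0 xs0 HL; apply: Wk_bound => //.
  by apply: mulr_ge0; [apply: mulr_ge0 => //; exact: sqr_ge0|lra].
move=> s p /andP[s0 sl] /andP[p0 pl].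
apply: (le_trans (PhiK_le_sqr _ _)); rewrite ?mulr_ge0 ?sqrtr_ge0//.
rewrite !exprMn sqr_sqrtr//.
have hs : s ^+ 2 <= 2 * (x + y).
  have := sqr_sqrtr (ltW x0); have := sqr_sqrtr (ltW y0).
  have : s ^+ 2 <= (Num.sqrt x + Num.sqrt y) ^+ 2.
    by rewrite ler_sqr ?nnegrE// addr_ge0 ?sqrtr_ge0.
  have := sqr_ge0 (Num.sqrt x - Num.sqrt y); nra.
have hp : p ^+ 2 <= 2 * (x + z).
  have := sqr_sqrtr (ltW x0); have := sqr_sqrtr (ltW z0).
  have : p ^+ 2 <= (Num.sqrt x + Num.sqrt z) ^+ 2.
    by rewrite ler_sqr ?nnegrE// addr_ge0 ?sqrtr_ge0.
  have := sqr_ge0 (Num.sqrt x - Num.sqrt z); nra.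
have b2 := sqr_ge0 b0; nra.
Qed.

Lemma Wk_sqrt_le (x y z : R) : 0 <= x -> 0 <= y -> 0 <= z -> x <= y + z ->
  Wk hphi x y z * Num.sqrt x <= 16 * b0 ^+ 2.
Proof.
have b2 := sqr_ge0 b0.
have s2 : Num.sqrt 2 <= (3 / 2 : R).
  by rewrite -(@ger0_norm _ (3 / 2)) ?divr_ge0// -sqrtr_sqr ler_wsqrtr//; lra.
have s20 : 0 <= Num.sqrt (2 : R) by exact: sqrtr_ge0.
have s22 : Num.sqrt (2 : R) ^+ 2 = 2 by rewrite sqr_sqrtr.
(* Common estimate for the boundary formulas of [Wk], after [sqrt x] has cancelled one root of the
   denominator. *)
have deg u v w : 0 <= u -> 0 <= v -> 0 < w -> u <= w -> v <= w ->
    PhiK hphi (Num.sqrt (2 * u)) (Num.sqrt (2 * v)) / Num.sqrt w <= 16 * b0 ^+ 2.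
  move=> u0 v0 w0 uw vw; rewrite ler_pdivrMr ?sqrtr_gt0//.
  apply: (le_trans (PhiK_le_lin _ _)); rewrite ?sqrtr_ge0//.
  rewrite !sqrtrM//.
  have := sqrtr_ge0 u; have := sqrtr_ge0 v.
  have := ler_wsqrtr uw; have := ler_wsqrtr vw; have := sqrtr_ge0 w.
  set U := Num.sqrt u; set V := Num.sqrt v; set W := Num.sqrt w; set q := Num.sqrt 2.
  move=> W0 VW UW V0 U0.
  have hU : q * U <= 3 / 2 * W by apply: ler_pM.
  have hV : q * V <= 3 / 2 * W by apply: ler_pM.
  nra.
rewrite !le_eqVlt => /predU1P[<-|x0] /predU1P[<-|y0] /predU1P[<-|z0];
  rewrite -?le_eqVlt => xyz; try by rewrite sqrtr0 mulr0 mulr_ge0.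
- lra.
- rewrite /Wk /= !(mulr0,mul0r) ltxx (gt_eqF x0) eqxx /= x0 /=.
  case: ifP => [xz|_]; last by rewrite (gt_eqF z0) !mul0r mulr_ge0.
  rewrite (sqrtrM _ (ltW x0)) (_ : _ / _ * _ =
    PhiK hphi (Num.sqrt (2 * x)) (Num.sqrt (2 * (z - x))) / Num.sqrt z).
    by apply: deg; rewrite ?subr_ge0 ?ltW//; lra.
  by field; rewrite !gt_eqF ?sqrtr_gt0.
- rewrite /Wk /= !(mulr0,mul0r) ltxx (gt_eqF x0) (gt_eqF y0) eqxx /= x0 /=.
  case: ifP => [xy|_]; last by rewrite !mul0r mulr_ge0.
  rewrite (sqrtrM _ (ltW x0)) (_ : _ / _ * _ =
    PhiK hphi (Num.sqrt (2 * (y - x))) (Num.sqrt (2 * x)) / Num.sqrt y).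
    by apply: deg; rewrite ?subr_ge0 ?ltW//; lra.
  by field; rewrite !gt_eqF ?sqrtr_gt0.
- have [xyz'|xs] := leP (y + z) x; first by rewrite Wk_eq0// mul0r mulr_ge0.
  have xs0 : 0 < xstar x y z by rewrite /xstar lt_max subr_gt0 xs.
  (* [m] and [M] are the smaller and the larger of [y] and [z]. Taking [L = sqrt m] leaves
     [S / sqrt M]. As [x <= 2 * M], the arguments satisfy [s + p <= 5 * sqrt M], and the linear
     bound yields [S = 16 * b0^2 * sqrt M]. *)
  have gen M m : 0 < M -> 0 < m -> (m = y) + (m = z) -> y <= M -> z <= M ->
      m * M = y * z -> Wk hphi x y z * Num.sqrt x <= 16 * b0 ^+ 2.
    move=> M0 m0 mE yM zM mM; rewrite -ler_pdivlMr ?sqrtr_gt0//.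
    have HL : Num.sqrt m \in [:: Num.sqrt x; Num.sqrt y; Num.sqrt z; Num.sqrt (xstar x y z)].
      by case: mE => ->; rewrite !inE eqxx ?orbT.
    apply: (@le_trans _ _ (Num.sqrt m * (16 * b0 ^+ 2 * Num.sqrt M) / Num.sqrt (x * y * z))).
      apply: Wk_bound => //; first by rewrite !mulr_ge0 ?sqrtr_ge0 ?b0_ge0.
      move=> s p /andP[s0 sl] /andP[p0 pl].
      apply: (le_trans (PhiK_le_lin _ _)); rewrite ?mulr_ge0//.
      have xM : Num.sqrt x <= 3 / 2 * Num.sqrt M.
        apply: (@le_trans _ _ (Num.sqrt 2 * Num.sqrt M)).
          by rewrite -sqrtrM// ler_wsqrtr//; lra.
        by rewrite ler_wpM2r ?sqrtr_ge0.
      have := ler_wsqrtr yM; have := ler_wsqrtr zM; have := sqrtr_ge0 M.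
      move: xM sl pl; set X := Num.sqrt x; set Y := Num.sqrt y; set Z := Num.sqrt z.
      set Q := Num.sqrt M; set q := Num.sqrt 2 => xM sl pl Q0 ZQ YQ.
      have h : s + p <= 5 * Q by lra.
      have hq : q * (s + p) <= 3 / 2 * (5 * Q) by apply: ler_pM => //; exact: addr_ge0.
      rewrite -mulrDr; nra.
    have -> : x * y * z = x * (m * M) by rewrite mM mulrA.
    rewrite (sqrtrM _ (ltW x0)) (sqrtrM _ (ltW m0)) le_eqVlt; apply/orP; left.
    by apply/eqP; field; rewrite !gt_eqF ?sqrtr_gt0.
  have [yz|zy] := leP y z.
    by apply: (gen z y) => //; left.
  by apply: (gen y z) => //; [right|exact: ltW|rewrite mulrC].
Qed.

End kernel_bounds.

(** * Inequalities for roots, and the change of variable in [s] *)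

Section real_lemmas.
Context {R : realType}.
Implicit Types a b c u v p q s t x y w rho lam : R.

(** After squaring, only the products differ. It decides which of the two constraints on [s] in the
    kernel is the active one. *)
Lemma sqrt_sum_le u v p q : 0 <= u -> 0 <= v -> 0 <= p -> 0 <= q ->
  u + v = p + q -> u * v <= p * q ->
  Num.sqrt u + Num.sqrt v <= Num.sqrt p + Num.sqrt q.
Proof.
move=> u0 v0 p0 q0 s m.
rewrite -ler_sqr ?nnegrE ?addr_ge0 ?sqrtr_ge0//.
have hm : Num.sqrt u * Num.sqrt v <= Num.sqrt p * Num.sqrt q.
  by rewrite -!sqrtrM// ler_wsqrtr.
have := sqr_sqrtr u0; have := sqr_sqrtr v0.
have := sqr_sqrtr p0; have := sqr_sqrtr q0; nra.
Qed.

(* The modulus squared is a convex combination of [(A + B)^2] and [(A - B)^2]. *)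
Lemma polar_scale A1 A2 B rho t : 0 <= B -> B <= A2 -> A2 <= A1 -> 1 <= rho ->
  A1 - B <= rho * (A2 - B) -> -1 <= t <= 1 ->
  A2 ^+ 2 + B ^+ 2 + 2 * A2 * B * t <= A1 ^+ 2 + B ^+ 2 + 2 * A1 * B * t /\
  A1 ^+ 2 + B ^+ 2 + 2 * A1 * B * t <=
    rho ^+ 2 * (A2 ^+ 2 + B ^+ 2 + 2 * A2 * B * t).
Proof.
move=> B0 BA2 A21 r1 h /andP[t1 t2].
have dec A : A ^+ 2 + B ^+ 2 + 2 * A * B * t =
    (1 + t) / 2 * (A + B) ^+ 2 + (1 - t) / 2 * (A - B) ^+ 2 by field.
have h' : A1 + B <= rho * (A2 + B) by nra.
rewrite !dec; split.
  apply: lerD; apply: ler_wpM2l; rewrite ?divr_ge0//; try lra;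
    rewrite ler_sqr ?nnegrE; lra.
have -> : rho ^+ 2 * ((1 + t) / 2 * (A2 + B) ^+ 2 + (1 - t) / 2 * (A2 - B) ^+ 2) =
    (1 + t) / 2 * (rho * (A2 + B)) ^+ 2 + (1 - t) / 2 * (rho * (A2 - B)) ^+ 2.
  by ring.
apply: lerD; apply: ler_wpM2l; rewrite ?divr_ge0//; try lra;
  rewrite ler_sqr ?nnegrE//; lra.
Qed.

(** By the law of cosines [(a - b + s^2) / (2 * s)] is the projection of the side [sqrt a] onto the
    side [s] in a triangle with sides [sqrt a], [sqrt b] and [s], hence at most [sqrt a] in absolute
    value. So the positive parts in [Ystar] are inactive over the range of integration. *)
Lemma w_le a b s : 0 <= a -> 0 <= b -> 0 < s ->
  Num.sqrt b - Num.sqrt a <= s -> s <= Num.sqrt a + Num.sqrt b ->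
  Num.sqrt a <= Num.sqrt b ->
  (a - b + s ^+ 2) ^+ 2 / (4 * s ^+ 2) <= a.
Proof.
move=> a0 b0; have := sqr_sqrtr a0; have := sqr_sqrtr b0.
move: (Num.sqrt a) (Num.sqrt b) (sqrtr_ge0 a) (sqrtr_ge0 b) => p q p0 q0 eb ea.
move=> s0 h1 h2 pq.
rewrite ler_pdivrMr; last by rewrite mulr_gt0// exprn_gt0.
have -> : a * (4 * s ^+ 2) = (2 * p * s) ^+ 2 by rewrite -ea; ring.
rewrite -[leLHS]real_normK ?num_real// ler_sqr ?nnegrE ?mulr_ge0 ?(ltW s0)//.
have g1 : 0 <= (q - (s - p)) * (q + (s - p)) by apply: mulr_ge0; lra.
have g2 : 0 <= (s + p - q) * (s + p + q) by apply: mulr_ge0; lra.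
rewrite ler_norml; apply/andP; split; lra.
Qed.

(* With [lam = y - x], the substitution [s = sroot lam w] turns
   [(x - y + s^2) / (2 s)] into [w], so that [Ystar] no longer depends on [lam]. *)
Definition sroot lam w := w + Num.sqrt (w ^+ 2 + lam).
Definition dsroot lam w := 1 + w / Num.sqrt (w ^+ 2 + lam).

Lemma srootD_gt0 lam w : 0 < lam -> 0 < w ^+ 2 + lam.
Proof. by move=> l0; rewrite ltr_wpDl// sqr_ge0. Qed.

Lemma norm_lt_srt lam w : 0 < lam -> `|w| < Num.sqrt (w ^+ 2 + lam).
Proof.
move=> l0; rewrite -sqrtr_sqr ltr_sqrt ?srootD_gt0//.
by rewrite ltrDl.
Qed.

Lemma sroot_gt0 lam w : 0 < lam -> 0 < sroot lam w.
Proof.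
move=> l0; have := norm_lt_srt w l0; have := ler_norm (- w); rewrite normrN /sroot.
lra.
Qed.

Lemma sroot_eq lam w : 0 < lam -> sroot lam w ^+ 2 - lam = 2 * w * sroot lam w.
Proof.
move=> l0; rewrite /sroot sqrrD sqr_sqrtr ?ltW ?srootD_gt0//; ring.
Qed.

Lemma dsrootE lam w : 0 < lam ->
  dsroot lam w = sroot lam w / Num.sqrt (w ^+ 2 + lam).
Proof.
move=> l0; rewrite /dsroot /sroot; field.
by rewrite gt_eqF// sqrtr_gt0 srootD_gt0.
Qed.

Lemma dsroot_ge0 lam w : 0 < lam -> 0 <= dsroot lam w.
Proof. by move=> l0; rewrite dsrootE// divr_ge0 ?sqrtr_ge0// ltW// sroot_gt0. Qed.

Lemma dsroot_le2 lam w : 0 < lam -> dsroot lam w <= 2.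
Proof.
move=> l0; have h := norm_lt_srt w l0; have h' := ler_norm w.
have s0 : 0 < Num.sqrt (w ^+ 2 + lam) by rewrite sqrtr_gt0 srootD_gt0.
by rewrite /dsroot -[leRHS]/(1 + 1) lerD2l ler_pdivrMr// mul1r (le_trans h')// ltW.
Qed.

(** The product of [sroot l w] with its conjugate [sqrt (w^2 + l) - w] is [l], and the conjugate
    increases with [l]; therefore [sroot l w / l] decreases. *)
Lemma sroot_scale l1 l2 w : 0 < l2 -> l2 <= l1 ->
  sroot l2 w <= sroot l1 w /\ sroot l1 w <= l1 / l2 * sroot l2 w.
Proof.
move=> l20 l21; have l10 : 0 < l1 by lra.
have hs : Num.sqrt (w ^+ 2 + l2) <= Num.sqrt (w ^+ 2 + l1).
  by rewrite ler_wsqrtr// lerD2l.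
split; first by rewrite /sroot lerD2l.
have h1 : sroot l1 w * (Num.sqrt (w ^+ 2 + l1) - w) = l1.
  by rewrite /sroot; have := sqr_sqrtr (ltW (srootD_gt0 w l10)); lra.
have h2 : sroot l2 w * (Num.sqrt (w ^+ 2 + l2) - w) = l2.
  by rewrite /sroot; have := sqr_sqrtr (ltW (srootD_gt0 w l20)); lra.
have p2 : 0 < Num.sqrt (w ^+ 2 + l2) - w.
  by have := norm_lt_srt w l20; have := ler_norm w; lra.
have g1 := sroot_gt0 w l10; have g2 := sroot_gt0 w l20.
rewrite mulrAC ler_pdivlMr//.
apply: (@le_trans _ _ (sroot l1 w * (sroot l2 w * (Num.sqrt (w ^+ 2 + l2) - w)))).
  by rewrite h2.
apply: (@le_trans _ _ (sroot l1 w * (Num.sqrt (w ^+ 2 + l1) - w) * sroot l2 w)).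
  by rewrite -mulrA ler_wpM2l ?(ltW g1)// mulrC ler_wpM2r ?(ltW g2)// lerD2r.
by rewrite h1.
Qed.

Lemma dsroot_scale l1 l2 w : 0 < l2 -> l2 <= l1 ->
  dsroot l1 w <= l1 / l2 * dsroot l2 w.
Proof.
move=> l20 l21; have l10 : 0 < l1 by lra.
have [_ h] := sroot_scale w l20 l21.
rewrite !dsrootE// mulrA; apply: ler_pM => //.
- by rewrite ltW// sroot_gt0.
- rewrite lef_pV2 ?posrE ?sqrtr_gt0 ?srootD_gt0//.
  by rewrite ler_wsqrtr// lerD2l.
Qed.

Lemma sroot_incr lam x y : 0 < lam -> x < y -> sroot lam x < sroot lam y.
Proof.
move=> l0 xy; rewrite /sroot.
have hx := norm_lt_srt x l0; have hy := norm_lt_srt y l0.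
have ex : Num.sqrt (x ^+ 2 + lam) ^+ 2 = x ^+ 2 + lam by rewrite sqr_sqrtr ?ltW ?srootD_gt0.
have ey : Num.sqrt (y ^+ 2 + lam) ^+ 2 = y ^+ 2 + lam by rewrite sqr_sqrtr ?ltW ?srootD_gt0.
have := ler_norm (- x); have := ler_norm (- y); rewrite !normrN.
move: ex ey hx hy; set X := Num.sqrt _; set Y := Num.sqrt (y ^+ 2 + lam) => ex ey hx hy ny nx.
have h : (X - Y) * (X + Y) = (y - x) * (- x - y) by lra.
have hp : 0 < X + Y by have := normr_ge0 x; have := normr_ge0 y; lra.
suff : X - Y < y - x by lra.
rewrite -(ltr_pM2r hp) h ltr_pM2l ?subr_gt0//; lra.
Qed.

Lemma is_derive_sroot lam w : 0 < lam -> is_derive w 1 (sroot lam) (dsroot lam w).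
Proof.
move=> l0; have s0 := srootD_gt0 w l0.
have hs : is_derive w 1 (fun w => w ^+ 2 + lam) (2 * w).
  apply: is_derive_eq; rewrite /GRing.scale/=; ring.
have hq := is_derive1_sqrt s0.
rewrite /sroot; apply: is_derive_eq.
rewrite /dsroot; field.
by rewrite gt_eqF// sqrtr_gt0.
Qed.

Lemma continuous_dsroot lam : 0 < lam -> continuous (dsroot lam).
Proof.
move=> l0 w; rewrite /dsroot; apply: cvgD; first exact: cvg_cst.
apply: cvgM; first exact: cvg_id.
apply: cvgV; first by rewrite gt_eqF// sqrtr_gt0 srootD_gt0.
apply: (@cvg_comp _ _ _ (fun w => w ^+ 2 + lam) Num.sqrt); last exact: sqrt_continuous.
by apply: cvgD; [exact: exprn_continuous|exact: cvg_cst].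
Qed.

(** The end points are the images of [- r] and [r]. Continuity is asked at positive points only,
    because [Ystar] has a separate value at [s = 0]; [sroot] never reaches [0]. *)
Lemma Rintegral_sroot (G : R -> R) lam r : 0 < lam -> 0 <= r ->
  (forall s, 0 < s -> {for s, continuous G}) ->
  Rintegral lebesgue_measure
    `[Num.sqrt (r ^+ 2 + lam) - r, Num.sqrt (r ^+ 2 + lam) + r]%classic G =
  Rintegral lebesgue_measure `[- r, r]%classic
    (fun w => G (sroot lam w) * dsroot lam w).
Proof.
move=> l0 r0 cG.
have dE : (sroot lam)^`()%classic = dsroot lam.
  apply/funext => w; rewrite derive1E.
  by have := is_derive_sroot w l0; move=> h; exact: derive_val.
have cs : continuous (sroot lam).
  move=> w; apply: differentiable_continuous; apply/derivable1_diffP.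
  by have := is_derive_sroot w l0; case.
have e1 : sroot lam (- r) = Num.sqrt (r ^+ 2 + lam) - r by rewrite /sroot sqrrN addrC.
have e2 : sroot lam r = Num.sqrt (r ^+ 2 + lam) + r by rewrite /sroot addrC.
rewrite /Rintegral -e1 -e2; congr fine.
rewrite integration_by_substitution_increasing//.
- by rewrite dE.
- by rewrite ge0_cp.
- by move=> x y _ _; exact: sroot_incr.
- by rewrite dE => x _; exact: continuous_dsroot.
- by rewrite dE; apply: cvgP; apply: cvg_at_right_filter; exact: continuous_dsroot.
- by rewrite dE; apply: cvgP; apply: cvg_at_left_filter; exact: continuous_dsroot.
- split.
  + by move=> x _; have := is_derive_sroot x l0; case.
  + by apply: cvg_at_right_filter; exact: cs.
  + by apply: cvg_at_left_filter; exact: cs.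
- apply: continuous_in_subspaceT => s; rewrite inE/= in_itv/= => /andP[h _].
  by apply: cG; exact: lt_le_trans (sroot_gt0 (- r) l0) h.
Qed.

End real_lemmas.

(** * Comparison of the kernel at [x = a] with the kernel at [x = b] *)

Section kernel_comparison.
Context {R : realType}.
Variables (hphi : R -> R) (b0 q1 : R).
Hypothesis chphi : continuous hphi.
Hypothesis hphi_ge0 : forall r, 0 <= hphi r.
Hypothesis hphi_le : forall r, hphi r <= b0.
Hypothesis hphi_ler : forall r, 0 <= r -> hphi r <= b0 * r.
Hypothesis q1_ge0 : 0 <= q1.
Hypothesis hphi_scale : forall rho r r', 1 <= rho <= Num.sqrt 2 ->
  0 <= r -> r <= r' -> r' <= rho * r ->
  hphi r' <= Num.sqrt (1 + q1 * (rho - 1)) * hphi r.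
Notation mu := (@lebesgue_measure R).

(** The square root in [hphi_scale] is there so that squaring the sum of two profiles produces
    exactly the factor [1 + q1 * (rho - 1)]. *)
Lemma PhiK_scale rho r r' p p' : 1 <= rho <= Num.sqrt 2 ->
  0 <= r -> r <= r' -> r' <= rho * r -> 0 <= p -> p <= p' -> p' <= rho * p ->
  PhiK hphi r' p' <= (1 + q1 * (rho - 1)) * PhiK hphi r p.
Proof.
move=> hrho r0 rr' rr p0 pp' pp; have /andP[rho1 _] := hrho.
have m0 : 0 <= 1 + q1 * (rho - 1) by rewrite addr_ge0// mulr_ge0// subr_ge0.
rewrite /PhiK -[X in _ <= X * _](sqr_sqrtr m0) -exprMn ler_sqr ?nnegrE; last 2 first.
- by rewrite addr_ge0.
- by rewrite mulr_ge0 ?sqrtr_ge0// addr_ge0.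
by rewrite mulrDr lerD// hphi_scale.
Qed.

Lemma Psi_scale (m s s' x y z x' y' z' : R) : 0 <= m ->
  (forall th, PhiK hphi (Num.sqrt 2 * s') (Num.sqrt 2 * Ystar x' y' z' s' th) <=
         m * PhiK hphi (Num.sqrt 2 * s) (Num.sqrt 2 * Ystar x y z s th)) ->
  Psi hphi x' y' z' s' <= m * Psi hphi x y z s.
Proof.
move=> m0 h.
have mP u v w t : measurable_fun setT (fun th =>
    PhiK hphi (Num.sqrt 2 * t) (Num.sqrt 2 * Ystar u v w t th)).
  by apply: measurable_PhiK => //; apply: measurable_funM => //; exact: measurable_Ystar.
have iP u v w t : mu.-integrable `[0, 2 * pi] (EFin \o (fun th =>
    PhiK hphi (Num.sqrt 2 * t) (Num.sqrt 2 * Ystar u v w t th))).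
  apply: (@bounded_itv_integrable _ _ (4 * b0 ^+ 2)) => // th.
  by rewrite PhiK_ge0 (PhiK_le hphi_ge0 hphi_le).
rewrite /Psi -RintegralZl//; apply: le_Rintegral => //.
- apply: (@bounded_itv_integrable _ _ (m * (4 * b0 ^+ 2))) => //.
    exact: measurable_funM.
  move=> th; rewrite mulr_ge0 ?PhiK_ge0//=.
  by rewrite ler_wpM2l// (PhiK_le hphi_ge0 hphi_le).
Qed.

Lemma xstarE (x y z : R) : x <= y + z -> xstar x y z = y + z - x.
Proof. by move=> h; rewrite /xstar max_l// subr_ge0. Qed.

(** For a sorted triple one of the two constraints on [s] implies the other at both ends, by
    [sqrt_sum_le]. With [c] as last argument the active constraint is the same whether [a] or [b]
    comes first. *)
Lemma sitv_small_first (a b c : R) : 0 <= a -> a <= b -> b <= c ->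
  slo a b c = Num.sqrt b - Num.sqrt a /\ shi a b c = Num.sqrt a + Num.sqrt b.
Proof.
move=> a0 ab bc; rewrite /slo /shi xstarE; last by lra.
have s1 : Num.sqrt a <= Num.sqrt b by rewrite ler_wsqrtr.
have s2 : Num.sqrt c <= Num.sqrt (b + c - a) by rewrite ler_wsqrtr//; lra.
have s3 : Num.sqrt a + Num.sqrt (b + c - a) <= Num.sqrt b + Num.sqrt c.
  apply: sqrt_sum_le; try lra; nra.
have s4 : Num.sqrt b <= Num.sqrt c by rewrite ler_wsqrtr.
split.
  rewrite distrC !ger0_norm ?subr_ge0// max_l//; lra.
rewrite min_l//; lra.
Qed.

Lemma sitv_small_second (a b c : R) : 0 <= a -> a <= b -> b <= c ->
  slo b a c = Num.sqrt b - Num.sqrt a /\ shi b a c = Num.sqrt a + Num.sqrt b.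
Proof.
move=> a0 ab bc; rewrite /slo /shi xstarE; last by lra.
have s1 : Num.sqrt a <= Num.sqrt b by rewrite ler_wsqrtr.
have s2 : Num.sqrt (a + c - b) <= Num.sqrt c by rewrite ler_wsqrtr//; lra.
have s5 : Num.sqrt a <= Num.sqrt (a + c - b) by rewrite ler_wsqrtr//; lra.
have s3 : Num.sqrt a + Num.sqrt c <= Num.sqrt b + Num.sqrt (a + c - b).
  apply: sqrt_sum_le; try lra; nra.
have s4 : Num.sqrt b <= Num.sqrt c by rewrite ler_wsqrtr.
split.
  rewrite [X in Num.max _ X]distrC !ger0_norm ?subr_ge0// max_l//; lra.
rewrite min_l//; lra.
Qed.

Lemma sitv_large_second (a b c : R) : 0 <= a -> a <= b -> b <= c ->
  slo a c b = Num.sqrt c - Num.sqrt a /\ shi a c b = Num.sqrt c + Num.sqrt a.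
Proof.
move=> a0 ab bc; rewrite /slo /shi xstarE; last by lra.
have s1 : Num.sqrt a <= Num.sqrt b by rewrite ler_wsqrtr.
have s2 : Num.sqrt c <= Num.sqrt (c + b - a) by rewrite ler_wsqrtr//; lra.
have s3 : Num.sqrt a + Num.sqrt (c + b - a) <= Num.sqrt b + Num.sqrt c.
  apply: sqrt_sum_le; try lra; nra.
have s4 : Num.sqrt b <= Num.sqrt c by rewrite ler_wsqrtr.
split.
  rewrite distrC !ger0_norm ?subr_ge0; try lra; rewrite max_l//; lra.
rewrite min_l//; lra.
Qed.

(** Here the constraint involving [xstar] is the active one. The interval has half-width [sqrt a],
    like that of [sitv_large_second], but a different centre; both become [[- sqrt a, sqrt a]] in
    the variable [w]. *)
Lemma sitv_large_first (a b c : R) : 0 <= a -> a <= b -> b <= c ->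
  slo b c a = Num.sqrt (c + a - b) - Num.sqrt a /\
  shi b c a = Num.sqrt (c + a - b) + Num.sqrt a.
Proof.
move=> a0 ab bc; rewrite /slo /shi xstarE; last by lra.
have s1 : Num.sqrt a <= Num.sqrt b by rewrite ler_wsqrtr.
have s2 : Num.sqrt (c + a - b) <= Num.sqrt c by rewrite ler_wsqrtr//; lra.
have s5 : Num.sqrt a <= Num.sqrt (c + a - b) by rewrite ler_wsqrtr//; lra.
have s3 : Num.sqrt a + Num.sqrt c <= Num.sqrt b + Num.sqrt (c + a - b).
  apply: sqrt_sum_le; try lra; nra.
have s4 : Num.sqrt b <= Num.sqrt c by rewrite ler_wsqrtr.
split.
  rewrite distrC !ger0_norm ?subr_ge0// max_r//; lra.
rewrite min_r//; lra.
Qed.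

(** Exchanging [a] and [b] raises the subtracted term [w] by exactly [b - a]. Hence the shorter
    length [B] is unchanged, while the squares of the longer ones exceed [B^2] by [c - a] and
    [c - b]. Dividing by [A1 + B >= A2 + B] gives the hypothesis of [polar_scale]. *)
Lemma Ystar_scale (a b c s th : R) : 0 < a -> a <= b -> b < c ->
  Num.sqrt b - Num.sqrt a <= s <= Num.sqrt a + Num.sqrt b ->
  Ystar b a c s th <= Ystar a b c s th /\
  Ystar a b c s th <= (c - a) / (c - b) * Ystar b a c s th.
Proof.
move=> a0 ab bc /andP[h1 h2].
have s1 : Num.sqrt a <= Num.sqrt b by rewrite ler_wsqrtr.
rewrite /Ystar; have [_|sn0] := eqVneq s 0; first by rewrite mulr0 lexx.
have s0 : 0 < s by rewrite lt_neqAle eq_sym sn0 /= (le_trans _ h1)// subr_ge0.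
have b_0 : 0 <= b by lra.
have hw := w_le (ltW a0) b_0 s0 h1 h2 s1.
set w1 := (a - b + s ^+ 2) ^+ 2 / (4 * s ^+ 2) in hw *.
have -> : (b - a + s ^+ 2) ^+ 2 / (4 * s ^+ 2) = w1 + (b - a) by rewrite /w1; field.
have e1 : posp (b - (w1 + (b - a))) = a - w1.
  by rewrite /posp max_l; [ring|rewrite subr_ge0; lra].
have e2 : posp (a - w1) = a - w1 by rewrite /posp max_l// subr_ge0.
have e3 : posp (c - (w1 + (b - a))) = (a - w1) + (c - b).
  by rewrite /posp max_l; [ring|lra].
have e4 : posp (c - w1) = (a - w1) + (c - a).
  by rewrite /posp max_l; [ring|lra].
rewrite e1 e2 e3 e4 !norm_add_polar.
have rho1 : 1 <= (c - a) / (c - b) by rewrite ler_pdivlMr; lra.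
set B := Num.sqrt (a - w1); set A1 := Num.sqrt (_ + (c - a)); set A2 := Num.sqrt (_ + (c - b)).
have B0 : 0 <= B by exact: sqrtr_ge0.
have BA : B <= A2 by rewrite ler_wsqrtr//; lra.
have AA : A2 <= A1 by rewrite ler_wsqrtr//; lra.
have E0 : B ^+ 2 = a - w1 by rewrite sqr_sqrtr// subr_ge0.
have E1 : A1 ^+ 2 = a - w1 + (c - a) by rewrite sqr_sqrtr//; lra.
have E2 : A2 ^+ 2 = a - w1 + (c - b) by rewrite sqr_sqrtr//; lra.
have hr : A1 - B <= (c - a) / (c - b) * (A2 - B).
  rewrite mulrAC ler_pdivlMr ?subr_gt0//.
  have -> : c - b = (A2 - B) * (A2 + B) by lra.
  have -> : c - a = (A1 - B) * (A1 + B) by lra.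
  rewrite -mulrA ler_wpM2l ?subr_ge0//; first lra.
  by rewrite mulrC ler_wpM2r ?subr_ge0// lerD2r.
have [g1 g2] := polar_scale B0 BA AA rho1 hr (t := cos th) ltac:(by rewrite cos_geN1 cos_le1).
split; first by rewrite ler_wsqrtr.
rewrite -[X in _ <= X * _]ger0_norm; last by lra.
by rewrite -sqrtr_sqr -sqrtrM ?sqr_ge0// ler_wsqrtr.
Qed.

(** This is the origin of the threshold [4 * b <= c]: it forces the ratio below
    [c / (c - b) <= 4 / 3], inside the interval where the assumption on [k] applies. *)
Lemma rho_le (a b c : R) : 0 <= a -> a <= b -> 0 < b -> 4 * b <= c ->
  1 <= (c - a) / (c - b) <= Num.sqrt 2.
Proof.
move=> a0 ab b_0 bc; have cb : 0 < c - b by lra.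
apply/andP; split; first by rewrite ler_pdivlMr; lra.
apply: (@le_trans _ _ (4 / 3)); first by rewrite ler_pdivrMr//; lra.
rewrite -[leLHS]ger0_norm ?divr_ge0// -sqrtr_sqr ler_wsqrtr//.
rewrite expr_div_n ler_pdivrMr; lra.
Qed.

(* Both kernels integrate over the same range of [s]; only [Ystar] changes. *)
Lemma Wk_compare_small (a b c : R) : 0 < a -> a <= b -> 4 * b <= c ->
  Wk hphi a b c <= (1 + q1 * ((c - a) / (c - b) - 1)) * Wk hphi b a c.
Proof.
move=> a0 ab bc.
have hrho := rho_le (ltW a0) ab ltac:(lra) bc.
set rho := (c - a) / (c - b) in hrho *; have /andP[rho1 rho2] := hrho.
have m0 : 0 <= 1 + q1 * (rho - 1) by rewrite addr_ge0// mulr_ge0// subr_ge0.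
have b_0 : 0 < b by lra.
have c0 : 0 < c by lra.
have xs1 : 0 < xstar a b c by rewrite xstarE; lra.
have xs2 : 0 < xstar b a c by rewrite xstarE; lra.
rewrite !WkE//.
have bc' : b <= c by lra.
have bc'' : b < c by lra.
have lab : c - b <= c - a by lra.
have [l1 u1] := sitv_small_first (ltW a0) ab bc'.
have [l2 u2] := sitv_small_second (ltW a0) ab bc'.
rewrite l1 l2 u1 u2 (mulrC b a) mulrCA ler_wpM2l//.
  by rewrite invr_ge0 !mulr_ge0 ?pi_ge0 ?sqrtr_ge0.
have iP u v w lo hi : mu.-integrable `[lo, hi] (EFin \o Psi hphi u v w).
  apply: (@bounded_itv_integrable _ _ (4 * b0 ^+ 2 * (2 * pi))).
    exact: measurable_Psi.
  by move=> s; exact: Psi_bounded.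
rewrite -RintegralZl//; last exact: iP.
apply: le_Rintegral => //; first exact: iP.
- apply: (@bounded_itv_integrable _ _ ((1 + q1 * (rho - 1)) * (4 * b0 ^+ 2 * (2 * pi)))).
    by apply: measurable_funM => //; exact: measurable_Psi.
  move=> s; have /andP[p0 p1] := Psi_bounded chphi hphi_ge0 hphi_le b a c s.
  by rewrite mulr_ge0//= ler_wpM2l.
- move=> s; rewrite /= in_itv/= => hs; apply: Psi_scale => // th.
  have [y1 y2] := Ystar_scale th a0 ab bc'' hs.
  have s0 : 0 <= s.
    by move: hs => /andP[+ _]; apply: le_trans; rewrite subr_ge0 ler_wsqrtr.
  apply: PhiK_scale => //.
  + by rewrite mulr_ge0 ?sqrtr_ge0.
  + by rewrite ler_peMl ?mulr_ge0 ?sqrtr_ge0.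
  + by rewrite mulr_ge0 ?sqrtr_ge0 ?Ystar_ge0.
  + by rewrite ler_wpM2l ?sqrtr_ge0.
  + by rewrite mulrCA ler_wpM2l ?sqrtr_ge0.
Qed.

(** At a given [w] the value is symmetric in [x] and [z] and free of [y], so the triples [(a, c, b)]
    and [(b, c, a)] produce the same [Ystar]. *)
Lemma Ystar_sroot (x y z lam w th : R) : 0 < lam -> lam = y - x ->
  Ystar x y z (sroot lam w) th = Num.sqrt (
    posp (z - w ^+ 2) + posp (x - w ^+ 2) +
    2 * Num.sqrt (posp (z - w ^+ 2)) * Num.sqrt (posp (x - w ^+ 2)) * cos th).
Proof.
move=> l0 lE; have s0 := sroot_gt0 w l0.
rewrite /Ystar (gt_eqF s0) /=.
have -> : (x - y + sroot lam w ^+ 2) ^+ 2 / (4 * sroot lam w ^+ 2) = w ^+ 2.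
  have -> : x - y + sroot lam w ^+ 2 = sroot lam w ^+ 2 - lam by rewrite lE; ring.
  by rewrite sroot_eq//; field; rewrite gt_eqF.
by rewrite norm_add_polar !sqr_sqrtr// /posp le_max lexx orbT.
Qed.

Lemma continuous_maxr0 : continuous (fun z : R => Num.max z 0).
Proof. by move=> z; apply: continuous_max; [exact: cvg_id|exact: cvg_cst]. Qed.

(** Continuity under the integral sign, on []s / 2, 2 * s[] to stay away from the separate value of
    [Ystar] at [0], with a constant as dominating function. *)
Lemma Psi_continuous (x y z s : R) : 0 < s -> {for s, continuous (Psi hphi x y z)}.
Proof.
move=> s0.
apply: (@continuity_under_integral R _ _ mu (fun s th => PhiK hphi (Num.sqrt 2 * s)
  (Num.sqrt 2 * Ystar x y z s th)) `[0, 2 * pi]%classic _ (s / 2) (2 * s) _ _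
  (cst (4 * b0 ^+ 2))) => //.
- move=> t _; apply: (@bounded_itv_integrable _ _ (4 * b0 ^+ 2)).
    by apply: measurable_PhiK => //; apply: measurable_funM => //; exact: measurable_Ystar.
  by move=> th; rewrite PhiK_ge0 (PhiK_le hphi_ge0 hphi_le).
- apply: aeW => th _ t; rewrite inE/= in_itv/= => /andP[t1 _].
  have t0 : 0 < t by lra.
  have cY : {for t, continuous (fun t => Ystar x y z t th)}.
    pose w t := (x - y + t ^+ 2) ^+ 2 / (4 * t ^+ 2).
    pose A t := Num.sqrt (posp (z - w t)).
    pose B t := Num.sqrt (posp (x - w t)).
    pose Y t := Num.sqrt ((A t + B t * cos th) ^+ 2 + (B t * sin th) ^+ 2).
    have cw : {for t, continuous w}.
      apply: cvgM.
        apply: (@cvg_comp _ _ _ (fun t => x - y + t ^+ 2) (fun u => u ^+ 2));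
          last exact: exprn_continuous.
        by apply: cvgD; [exact: cvg_cst|exact: exprn_continuous].
      apply: cvgV; first by rewrite gt_eqF// mulr_gt0// exprn_gt0.
      by apply: cvgM; [exact: cvg_cst|exact: exprn_continuous].
    have cp v : {for t, continuous (fun t => Num.sqrt (posp (v - w t)))}.
      apply: (@cvg_comp _ _ _ (fun t => posp (v - w t)) Num.sqrt);
        last exact: sqrt_continuous.
      apply: (@cvg_comp _ _ _ (fun t => v - w t) (fun z => Num.max z 0));
        last exact: continuous_maxr0.
      by apply: cvgB => //; exact: cvg_cst.
    have cYY : {for t, continuous Y}.
      apply: (@cvg_comp _ _ _ (fun t => _ ) Num.sqrt); last exact: sqrt_continuous.
      apply: cvgD.
        apply: (@cvg_comp _ _ _ (fun t => A t + B t * cos th) (fun u => u ^+ 2));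
          last exact: exprn_continuous.
        apply: cvgD; first exact: cp.
        by apply: cvgM; [exact: cp|exact: cvg_cst].
      apply: (@cvg_comp _ _ _ (fun t => B t * sin th) (fun u => u ^+ 2));
          last exact: exprn_continuous.
      by apply: cvgM; [exact: cp|exact: cvg_cst].
    have YE : \forall u \near t, Y u = Ystar x y z u th.
      near=> u; have u0 : 0 < u by near: u; exact: lt_nbhsr.
      by rewrite /Ystar (gt_eqF u0).
    rewrite /prop_for/continuous_at /Ystar (gt_eqF t0) -/(Y t).
    by apply: cvg_trans cYY; apply: near_eq_cvg.
  apply: (@cvg_comp _ _ _ (fun t => hphi (Num.sqrt 2 * t) +
     hphi (Num.sqrt 2 * Ystar x y z t th)) (fun u => u ^+ 2)); last exact: exprn_continuous.
  apply: cvgD.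
    apply: (@cvg_comp _ _ _ (fun t => Num.sqrt 2 * t) hphi); last exact: chphi.
    by apply: cvgM; [exact: cvg_cst|exact: cvg_id].
  apply: (@cvg_comp _ _ _ (fun t => Num.sqrt 2 * Ystar x y z t th) hphi); last exact: chphi.
  by apply: cvgM; [exact: cvg_cst|exact: cY].
- apply: (@bounded_itv_integrable _ _ (4 * b0 ^+ 2)) => // th /=.
  by rewrite lexx mulr_ge0// sqr_ge0.
- move=> t _; apply: aeW => th _.
  by rewrite ger0_norm ?PhiK_ge0// (PhiK_le hphi_ge0 hphi_le).
- rewrite inE/= in_itv/=; lra.
Unshelve. all: by end_near.
Qed.

(* Here the ranges of [s] differ, but become the same range of [w] under [sroot]. *)
Lemma Wk_compare_large (a b c : R) : 0 < a -> a <= b -> 4 * b <= c ->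
  Wk hphi a c b <= (c - a) / (c - b) * (1 + q1 * ((c - a) / (c - b) - 1)) *
    Wk hphi b c a.
Proof.
move=> a0 ab bc.
have hrho := rho_le (ltW a0) ab ltac:(lra) bc.
set rho := (c - a) / (c - b) in hrho *; have /andP[rho1 rho2] := hrho.
have m0 : 0 <= 1 + q1 * (rho - 1) by rewrite addr_ge0// mulr_ge0// subr_ge0.
have b_0 : 0 < b by lra.
have c0 : 0 < c by lra.
have xs1 : 0 < xstar a c b by rewrite xstarE; lra.
have xs2 : 0 < xstar b c a by rewrite xstarE; lra.
rewrite !WkE//.
have bc' : b <= c by lra.
have bc'' : b < c by lra.
have lab : c - b <= c - a by lra.
have [l1 u1] := sitv_large_second (ltW a0) ab bc'.
have [l2 u2] := sitv_large_first (ltW a0) ab bc'.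
rewrite l1 l2 u1 u2 (_ : b * c * a = a * c * b); last by ring.
rewrite mulrCA ler_wpM2l//.
  by rewrite invr_ge0 !mulr_ge0 ?pi_ge0 ?sqrtr_ge0.
have la : 0 < c - a by lra.
have lb : 0 < c - b by lra.
have ra : 0 <= Num.sqrt a := sqrtr_ge0 a.
have -> : c + a - b = Num.sqrt a ^+ 2 + (c - b) by rewrite sqr_sqrtr ?ltW//; ring.
have ec : c = Num.sqrt a ^+ 2 + (c - a) by rewrite sqr_sqrtr ?ltW//; ring.
rewrite {1 2}ec.
rewrite (Rintegral_sroot la ra); last by move=> s; exact: Psi_continuous.
rewrite (Rintegral_sroot lb ra); last by move=> s; exact: Psi_continuous.
have mi x y z lam : 0 < lam -> measurable_fun setT
    (fun w => Psi hphi x y z (sroot lam w) * dsroot lam w).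
  move=> l0; apply: measurable_funM.
    apply: measurable_Psi => //; apply: measurable_funD => //.
    apply: measurable_fun_sqrt; apply: measurable_funD => //; exact: measurable_funX.
  by apply: continuous_measurable_fun; exact: continuous_dsroot.
have bi x y z lam : 0 < lam -> forall w,
    0 <= Psi hphi x y z (sroot lam w) * dsroot lam w <= 4 * b0 ^+ 2 * (2 * pi) * 2.
  move=> l0 w.
  have /andP[p0 p1] := Psi_bounded chphi hphi_ge0 hphi_le x y z (sroot lam w).
  have d0 := dsroot_ge0 w l0; have d2 := dsroot_le2 w l0.
  by rewrite mulr_ge0//= ler_pM.
rewrite -RintegralZl//; last first.
  by apply: (bounded_itv_integrable _ _ (mi _ _ _ _ lb) (bi _ _ _ _ lb)).
apply: le_Rintegral => //.
- by apply: (bounded_itv_integrable _ _ (mi _ _ _ _ la) (bi _ _ _ _ la)).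
- apply: (@bounded_itv_integrable _ _ (rho * (1 + q1 * (rho - 1)) *
    (4 * b0 ^+ 2 * (2 * pi) * 2))).
    by apply: measurable_funM => //; exact: mi.
  move=> w; have /andP[p0 p1] := bi b c a (c - b) lb w.
  have h0 : 0 <= rho * (1 + q1 * (rho - 1)) by rewrite mulr_ge0//; lra.
  by rewrite mulr_ge0//= ler_wpM2l.
- move=> w _.
  have [s1 s2] := sroot_scale w lb lab.
  have ds := dsroot_scale w lb lab.
  rewrite -/rho in s2 ds.
  (* The Jacobian costs one factor [rho], and the stretched first argument of [PhiK] costs
     [1 + q1 * (rho - 1)]. *)
  have -> : rho * (1 + q1 * (rho - 1)) * (Psi hphi b c a (sroot (c - b) w) * dsroot (c - b) w)
    = ((1 + q1 * (rho - 1)) * Psi hphi b c a (sroot (c - b) w)) * (rho * dsroot (c - b) w).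
    by ring.
  apply: ler_pM => //; [exact: Psi_ge0|exact: dsroot_ge0|].
  apply: Psi_scale => // th.
  rewrite !Ystar_sroot//.
  set Y1 := Num.sqrt (_ + _ * cos th); set Y2 := Num.sqrt (_ + _ * cos th).
  have -> : Y1 = Y2.
    by rewrite /Y1 /Y2; congr (Num.sqrt (_ + _ * _)); [exact: addrC|exact: mulrAC].
  have Y20 : 0 <= Y2 by exact: sqrtr_ge0.
  have g0 := sroot_gt0 w lb.
  apply: PhiK_scale => //.
  + by rewrite mulr_ge0 ?sqrtr_ge0// ltW.
  + by rewrite ler_wpM2l ?sqrtr_ge0.
  + by rewrite mulrCA ler_wpM2l ?sqrtr_ge0.
  + by rewrite mulr_ge0 ?sqrtr_ge0.
  + by rewrite ler_peMl ?mulr_ge0 ?sqrtr_ge0.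
Qed.

End kernel_comparison.

Ltac nonneg := repeat (first [assumption | exact: ler0n | exact: ler01
  | exact: sqr_ge0 | exact: sqrtr_ge0 | exact: testf_ge0
  | apply: mulr_ge0 | apply: addr_ge0]); try lra.

(** * The symmetrised cubic integrand *)

Section cubic_bound.
Context {R : realType}.
Variables (hphi : R -> R) (b0 q1 : R).
Hypothesis chphi : continuous hphi.
Hypothesis hphi_ge0 : forall r, 0 <= hphi r.
Hypothesis hphi_le : forall r, hphi r <= b0.
Hypothesis hphi_ler : forall r, 0 <= r -> hphi r <= b0 * r.
Hypothesis q1_ge0 : 0 <= q1.
Hypothesis hphi_scale : forall rho r r', 1 <= rho <= Num.sqrt 2 ->
  0 <= r -> r <= r' -> r' <= rho * r ->
  hphi r' <= Num.sqrt (1 + q1 * (rho - 1)) * hphi r.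
Variable m : R.
Hypothesis m_gt0 : 0 < m.
Notation phi := (testf m).

(* Dominates [sqrt (x_* / a)] on the support [x_* < 1/m]; it is [0] at [a = 0],
   where the kernel vanishes. *)
Definition errf (a : R) : R :=
  if 0 < a then Num.min 1 (Num.sqrt (m * a))^-1 else 0.

Lemma errf_ge0 a : 0 <= errf a.
Proof. by rewrite /errf; case: ifP => // _; rewrite le_min ler01/= invr_ge0 sqrtr_ge0. Qed.

Lemma errf_le1 a : errf a <= 1.
Proof. by rewrite /errf; case: ifP => // _; rewrite ge_min lexx. Qed.

Lemma Wk0bc b c : 0 < b -> 0 < c -> Wk hphi 0 b c =
  PhiK hphi (Num.sqrt (2 * b)) (Num.sqrt (2 * c)) / Num.sqrt (b * c).
Proof. by move=> h1 h2; rewrite /Wk /= !(mulr0, mul0r) ltxx eqxx h1 h2. Qed.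

Lemma Wkb0c b c : 0 < b -> b < c -> Wk hphi b 0 c =
  PhiK hphi (Num.sqrt (2 * b)) (Num.sqrt (2 * (c - b))) / Num.sqrt (b * c).
Proof.
by move=> h1 h2; rewrite /Wk /= !(mulr0, mul0r) ltxx eqxx h1 h2 (gt_eqF h1).
Qed.

Lemma Wkbc0 b c : 0 < b -> b < c -> Wk hphi b c 0 =
  PhiK hphi (Num.sqrt (2 * (c - b))) (Num.sqrt (2 * b)) / Num.sqrt (b * c).
Proof.
move=> h1 h2; have h3 := lt_trans h1 h2.
by rewrite /Wk /= !(mulr0, mul0r) ltxx eqxx h1 h2 (gt_eqF h1) (gt_eqF h3).
Qed.

Lemma Wk_y0 x z : z <= x -> Wk hphi x 0 z = 0.
Proof.
move=> zx; rewrite /Wk /= !(mulr0, mul0r) ltxx.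
case: ifP => [/andP[/andP[_ h] _]|_]; first by [].
case: ifP => [/andP[_ xz]|_]; first by rewrite ltNge zx in xz.
case: ifP => [/andP[/andP[_ x0] x0']|//].
by have := lt_trans x0 x0'; rewrite ltxx.
Qed.

Lemma Wk_z0 x y : y <= x -> Wk hphi x y 0 = 0.
Proof.
move=> yx; rewrite /Wk /= !(mulr0, mul0r) ltxx.
case: ifP => [/andP[_ h]|_]; first by [].
case: ifP => [/andP[/andP[_ x0] x0']|_].
  by have := lt_trans x0 x0'; rewrite ltxx.
by case: ifP => [/andP[_ xy]|//]; rewrite ltNge yx in xy.
Qed.

Lemma PhiK_sqrt2_le u v : 0 <= u -> 0 <= v ->
  PhiK hphi (Num.sqrt (2 * u)) (Num.sqrt (2 * v)) <= 4 * b0 ^+ 2 * (u + v).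
Proof.
move=> u0 v0; apply: (le_trans (PhiK_le_sqr hphi_ge0 hphi_le hphi_ler _ _)).
- exact: sqrtr_ge0.
- exact: sqrtr_ge0.
by rewrite !sqr_sqrtr ?mulr_ge0//; lra.
Qed.

(** Choosing [L = sqrt a] for the smallest entry cancels [sqrt a] in the denominator, so the bound
    stays finite as [a] tends to [0] and can match the boundary formulas there. *)
Lemma Wk_pos_le (a b c x y z : R) : 0 < x -> 0 < y -> 0 < z -> 0 < xstar x y z ->
  0 < a -> Num.sqrt a \in [:: Num.sqrt x; Num.sqrt y; Num.sqrt z; Num.sqrt (xstar x y z)] ->
  0 < b -> 0 < c -> x * y * z = a * (b * c) -> 2 * x + y + z <= 3 * b + c ->
  Wk hphi x y z <= 8 * b0 ^+ 2 * (3 * b + c) / Num.sqrt (b * c).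
Proof.
move=> x0 y0 z0 xs a0 HL b_0 c0 E h.
apply: (le_trans (Wk_le_sqr chphi hphi_ge0 hphi_le hphi_ler x0 y0 z0 xs HL)).
have sa : 0 < Num.sqrt a by rewrite sqrtr_gt0.
have sbc : 0 < Num.sqrt (b * c) by rewrite sqrtr_gt0 mulr_gt0.
rewrite E (sqrtrM _ (ltW a0)) invfM mulrACA mulfV ?gt_eqF// mul1r.
by rewrite ler_wpM2r ?invr_ge0 ?(ltW sbc)// ler_wpM2l//; nonneg.
Qed.

Lemma Wk_le4 (a b c : R) : 0 <= a -> a <= b -> 0 < b -> b <= c ->
  let C := 8 * b0 ^+ 2 * (3 * b + c) / Num.sqrt (b * c) in
  [/\ Wk hphi a b c <= C, Wk hphi a c b <= C, Wk hphi b a c <= C &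
     Wk hphi b c a <= C].
Proof.
move=> a0 ab b_0 bc C; have c0 : 0 < c by lra.
have b2 := sqr_ge0 b0.
have sbc : 0 < Num.sqrt (b * c) by rewrite sqrtr_gt0 mulr_gt0.
have C0 : 0 <= C by apply: divr_ge0; [nonneg|exact: ltW].
have bc0 : 0 <= c - b by lra.
have c0' := ltW c0; have b_0' := ltW b_0.
move: a0; rewrite le_eqVlt => /predU1P[a0|a0].
  rewrite -a0; split.
  - rewrite Wk0bc// ler_wpM2r ?invr_ge0 ?(ltW sbc)//.
    by apply: (le_trans (PhiK_sqrt2_le _ _)) => //; nra.
  - rewrite Wk0bc// (mulrC c) ler_wpM2r ?invr_ge0 ?(ltW sbc)//.
    by apply: (le_trans (PhiK_sqrt2_le _ _)) => //; nra.
  - have [cb|bc'] := leP c b; first by rewrite Wk_y0.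
    rewrite Wkb0c// ler_wpM2r ?invr_ge0 ?(ltW sbc)//.
    by apply: (le_trans (PhiK_sqrt2_le _ _)) => //; nra.
  - have [cb|bc'] := leP c b; first by rewrite Wk_z0.
    rewrite Wkbc0// ler_wpM2r ?invr_ge0 ?(ltW sbc)//.
    by apply: (le_trans (PhiK_sqrt2_le _ _)) => //; nra.
have x1 : 0 < xstar a b c by rewrite xstarE; lra.
have x2 : 0 < xstar a c b by rewrite xstarE; lra.
have x3 : 0 < xstar b a c by rewrite xstarE; lra.
have x4 : 0 < xstar b c a by rewrite xstarE; lra.
split; apply: (Wk_pos_le (a := a)) => //; rewrite ?inE ?eqxx ?orbT//; try lra; ring.
Qed.

Lemma Wk_compare (a b c : R) : 0 <= a -> a <= b -> 0 < b -> 4 * b <= c ->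
  let rho := (c - a) / (c - b) in let M := rho * (1 + q1 * (rho - 1)) in
  Wk hphi a b c <= M * Wk hphi b a c /\ Wk hphi a c b <= M * Wk hphi b c a.
Proof.
move=> a0 ab b_0 bc rho M.
have hrho := rho_le a0 ab b_0 bc; rewrite -/rho in hrho.
have /andP[rho1 _] := hrho.
have mM : 1 + q1 * (rho - 1) <= M.
  by rewrite ler_peMl// addr_ge0// mulr_ge0// subr_ge0.
move: a0; rewrite le_eqVlt => /predU1P[a0|a0]; last first.
  split; last exact: Wk_compare_large.
  apply: (le_trans (Wk_compare_small chphi hphi_ge0 hphi_le q1_ge0 hphi_scale a0 ab bc)).
  by rewrite ler_wpM2r// Wk_ge0.
have c0 : 0 < c by lra.
have bc' : b < c by lra.
have cb : 0 < c - b by lra.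
rewrite -a0.
have rE : rho * (c - b) = c by rewrite /rho -a0; field; rewrite gt_eqF.
(* At [a = 0] the boundary formulas differ in one argument only. The ratio of the two values is
   [sqrt rho], which is at most [rho]. *)
have hs : Num.sqrt (2 * c) <= rho * Num.sqrt (2 * (c - b)).
  rewrite -[X in _ <= X * _]ger0_norm; last by lra.
  rewrite -sqrtr_sqr -sqrtrM ?sqr_ge0// ler_wsqrtr//.
  have -> : rho ^+ 2 * (2 * (c - b)) = 2 * rho * c by rewrite -{2}rE; ring.
  nra.
have hs1 : Num.sqrt (2 * (c - b)) <= Num.sqrt (2 * c) by rewrite ler_wsqrtr//; lra.
have sb := sqrtr_ge0 (2 * b).
have P0 u v : 0 <= PhiK hphi u v by exact: PhiK_ge0.
split.
- rewrite Wk0bc// Wkb0c// mulrA ler_wpM2r ?invr_ge0 ?sqrtr_ge0//.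
  apply: (@le_trans _ _ ((1 + q1 * (rho - 1)) *
    PhiK hphi (Num.sqrt (2 * b)) (Num.sqrt (2 * (c - b))))); last by rewrite ler_wpM2r.
  by apply: (PhiK_scale hphi_ge0 q1_ge0 hphi_scale) => //; rewrite ?sqrtr_ge0// ler_peMl.
- rewrite Wk0bc// Wkbc0// (mulrC c b) mulrA ler_wpM2r ?invr_ge0 ?sqrtr_ge0//.
  apply: (@le_trans _ _ ((1 + q1 * (rho - 1)) *
    PhiK hphi (Num.sqrt (2 * (c - b))) (Num.sqrt (2 * b)))); last by rewrite ler_wpM2r.
  by apply: (PhiK_scale hphi_ge0 q1_ge0 hphi_scale) => //; rewrite ?sqrtr_ge0// ler_peMl.
Qed.

(** With [p = sqrt b] and [q = sqrt c] the left side depends on [q / p >= 2] only, and is largest at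
    [c = 4 * b], where it equals [28 / 3] times [b0^2]. *)
Lemma far_const b c : 0 < b -> 4 * b <= c ->
  8 * b0 ^+ 2 * (3 * b + c) / Num.sqrt (b * c) * (b / (c - b)) <= 10 * b0 ^+ 2.
Proof.
move=> b_0 bc; have c0 : 0 < c by lra.
have eb := sqr_sqrtr (ltW b_0); have ec := sqr_sqrtr (ltW c0).
have h2 : 2 * Num.sqrt b <= Num.sqrt c.
  rewrite -[X in X * _]ger0_norm// -sqrtr_sqr -sqrtrM ?sqr_ge0// ler_wsqrtr//; lra.
rewrite (sqrtrM _ (ltW b_0)).
have sb : 0 < Num.sqrt b by rewrite sqrtr_gt0.
have sc : 0 < Num.sqrt c by rewrite sqrtr_gt0.
move: (Num.sqrt b) (Num.sqrt c) eb ec h2 sb sc => p q eb ec h2 sb sc.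
have d0 : 0 < q ^+ 2 - p ^+ 2 by rewrite eb ec; lra.
rewrite -eb -ec.
have -> : 8 * b0 ^+ 2 * (3 * p ^+ 2 + q ^+ 2) / (p * q) * (p ^+ 2 / (q ^+ 2 - p ^+ 2)) =
   b0 ^+ 2 * (8 * (3 * p ^+ 2 + q ^+ 2) * p / (q * (q ^+ 2 - p ^+ 2))).
  by field; rewrite !gt_eqF.
rewrite [leRHS]mulrC ler_wpM2l ?sqr_ge0// ler_pdivrMr ?mulr_gt0//.
have -> : 10 * (q * (q ^+ 2 - p ^+ 2)) = 10 * q * (q ^+ 2 - p ^+ 2) by ring.
have k1 : 8 * (3 * p ^+ 2 + q ^+ 2) <= 14 * q ^+ 2 by nra.
have k2 : 15 / 2 * q ^+ 2 <= 10 * (q ^+ 2 - p ^+ 2) by nra.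
have k3 : 0 <= q * (10 * (q ^+ 2 - p ^+ 2) - 15 / 2 * q ^+ 2).
  by rewrite mulr_ge0 ?subr_ge0// ltW.
have k4 : 0 <= p * (14 * q ^+ 2 - 8 * (3 * p ^+ 2 + q ^+ 2)).
  by rewrite mulr_ge0 ?subr_ge0// ltW.
have k5 : 0 <= (q - 2 * p) * q ^+ 2 by rewrite mulr_ge0 ?subr_ge0// sqr_ge0.
nra.
Qed.

(** With [p = sqrt b] and [q = sqrt c], the constraint [p <= q <= 2 * p] gives
    [3 * p^2 + q^2 <= 5 * p * q]. *)
Lemma near_const b c : 0 < b -> b <= c -> c <= 4 * b ->
  8 * b0 ^+ 2 * (3 * b + c) / Num.sqrt (b * c) <= 40 * b0 ^+ 2.
Proof.
move=> b_0 bc cb; have c0 : 0 < c by lra.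
have eb := sqr_sqrtr (ltW b_0); have ec := sqr_sqrtr (ltW c0).
have h2 : Num.sqrt c <= 2 * Num.sqrt b.
  rewrite -[X in _ <= X * _]ger0_norm// -sqrtr_sqr -sqrtrM ?sqr_ge0// ler_wsqrtr//; lra.
have h1 : Num.sqrt b <= Num.sqrt c by rewrite ler_wsqrtr.
have b2 := sqr_ge0 b0.
rewrite (sqrtrM _ (ltW b_0)).
have sb : 0 < Num.sqrt b by rewrite sqrtr_gt0.
have sc : 0 < Num.sqrt c by rewrite sqrtr_gt0.
move: (Num.sqrt b) (Num.sqrt c) eb ec h2 h1 sb sc => p q eb ec h2 h1 sb sc.
rewrite -eb -ec ler_pdivrMr ?mulr_gt0//.
have -> : 40 * b0 ^+ 2 * (p * q) = 8 * b0 ^+ 2 * (5 * (p * q)) by ring.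
rewrite ler_wpM2l//; [nonneg|nra].
Qed.

(** Stated for abstract [W1] and [W2] so as to serve both positions of [c]. Convexity gives
    [0 <= D1] and [D2 <= 0]. If [c < 4 * b] the loss is dropped. Otherwise, with [M] the comparison
    factor, the pair is at most [W2 * ((M - 1) * D1 + (D1 + D2))]; both summands are multiples of
    [t * phi a], and [W2 * t] is bounded by [far_const]. *)
Lemma gain_loss_le (a b c W1 W2 D1 D2 : R) : 0 <= a -> a <= b -> 0 < b -> b <= c ->
  0 <= W1 -> 0 <= W2 ->
  W1 <= 8 * b0 ^+ 2 * (3 * b + c) / Num.sqrt (b * c) ->
  W2 <= 8 * b0 ^+ 2 * (3 * b + c) / Num.sqrt (b * c) ->
  (4 * b <= c -> W1 <= (c - a) / (c - b) * (1 + q1 * ((c - a) / (c - b) - 1)) * W2) ->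
  D1 = phi a + phi (b + c - a) - phi b - phi c ->
  D2 = phi b + phi (a + c - b) - phi a - phi c ->
  W1 * D1 + W2 * D2 <= 40 * b0 ^+ 2 * (1 + q1) * phi a.
Proof.
move=> a0 ab b_0 bc W10 W20 hW1 hW2 hW12 E1 E2.
have c0 : 0 < c by lra.
have b2 := sqr_ge0 b0.
have pa := testf_ge0 m a; have pb := testf_ge0 m b; have pc := testf_ge0 m c.
have D1le : D1 <= phi a.
  by have := testf_nincr (ltW m_gt0) (ltac:(lra) : c <= b + c - a); lra.
have D1ge : 0 <= D1.
  have := @testf_majorize _ m a b (b + c - a) ltac:(lra).
  have -> : a + (b + c - a) - b = c by ring.
  lra.
have D2le : D2 <= 0.
  by have := @testf_majorize _ m a b c ltac:(lra); lra.
have [bc4|cb4] := leP (4 * b) c; last first.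
  have : W2 * D2 <= 0 by rewrite mulr_ge0_le0.
  have : W1 * D1 <= 40 * b0 ^+ 2 * phi a.
    apply: ler_pM => //; apply: (le_trans hW1); apply: near_const => //; lra.
  have : 0 <= 40 * b0 ^+ 2 * phi a * q1 by nonneg.
  lra.
have cb : 0 < c - b by lra.
have ca : 0 < c - a by lra.
have /andP[rho1 rho2] := rho_le a0 ab b_0 bc4.
have {}rho2 : (c - a) / (c - b) <= 2 by rewrite ler_pdivrMr//; lra.
have rE : (c - a) / (c - b) - 1 = (b - a) / (c - b) by field; rewrite gt_eqF.
move: (hW12 bc4) => {hW12}; rewrite rE.
set rho := (c - a) / (c - b) in rho1 rho2 rE *.
set t := (b - a) / (c - b) in rE * => hW12.
have t0 : 0 <= t by rewrite divr_ge0//; lra.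
have sl : D1 + D2 <= t * phi a.
  have e : D1 + D2 <= phi (a + c - b) - phi c.
    by have := testf_nincr (ltW m_gt0) (ltac:(lra) : c <= b + c - a); lra.
  apply: (le_trans e).
  have h := @testf_slope _ m a b c ltac:(lra) (ltW m_gt0).
  apply: (@le_trans _ _ ((b - a) / (c - a) * phi a)).
    by rewrite mulrAC ler_pdivlMr// mulrC.
  rewrite ler_wpM2r// /t ler_wpM2l ?subr_ge0// lef_pV2 ?posrE//; lra.
have tW : W2 * t <= 10 * b0 ^+ 2.
  apply: (le_trans _ (far_const b_0 bc4)).
  apply: ler_pM => //.
  by rewrite /t ler_wpM2r ?invr_ge0 ?(ltW cb)//; lra.
have h1 : W1 * D1 + W2 * D2 <= W2 * ((rho * (1 + q1 * t) - 1) * D1 + (D1 + D2)).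
  have : 0 <= (rho * (1 + q1 * t) * W2 - W1) * D1 by rewrite mulr_ge0// subr_ge0.
  lra.
(* As [rho = 1 + t], the bracket equals [t + q1 * t * rho], and [rho <= 2]. *)
have h2 : (rho * (1 + q1 * t) - 1) * D1 <= t * (1 + 2 * q1) * phi a.
  apply: ler_pM => //.
    have : 0 <= q1 * t by exact: mulr_ge0.
    nra.
  have rt : rho = 1 + t by lra.
  have : 0 <= q1 * t * (2 - rho) by apply: mulr_ge0; [exact: mulr_ge0|lra].
  by rewrite rt; nra.
have h3 : W2 * ((rho * (1 + q1 * t) - 1) * D1 + (D1 + D2)) <=
    W2 * (t * (2 + 2 * q1) * phi a).
  by rewrite ler_wpM2l//; lra.
have h4 : W2 * (t * (2 + 2 * q1) * phi a) <= 10 * b0 ^+ 2 * (2 + 2 * q1) * phi a.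
  have k0 : 0 <= (2 + 2 * q1) * phi a by nonneg.
  have : 0 <= (10 * b0 ^+ 2 - W2 * t) * ((2 + 2 * q1) * phi a).
    by apply: mulr_ge0; rewrite ?subr_ge0.
  lra.
have : 0 <= b0 ^+ 2 * (1 + q1) * phi a by nonneg.
lra.
Qed.

(** When [x] is the largest entry, [phi x <= phi z], so at most [phi (xstar x y z)] survives in
    [Delta]. It vanishes unless [xstar < 1 / m], and taking [L] as the root of [xstar] in the kernel
    bound turns this into smallness. *)
Lemma Kk_max_first_le (x y z : R) : 0 <= y -> 0 <= z -> y <= x -> z <= x ->
  Kk hphi phi x y z <= 64 * b0 ^+ 2 * (errf y + errf z).
Proof.
move=> y0 z0 yx zx; rewrite /Kk.
have b2 := sqr_ge0 b0.
have r0 : 0 <= 64 * b0 ^+ 2 * (errf y + errf z).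
  by have := errf_ge0 y; have := errf_ge0 z; move=> ? ?; nonneg.
move: y0; rewrite le_eqVlt => /predU1P[y0|y0]; first by move: r0; rewrite -y0 Wk_y0// mul0r.
move: z0; rewrite le_eqVlt => /predU1P[z0|z0]; first by move: r0; rewrite -z0 Wk_z0// mul0r.
have x0 : 0 < x by lra.
have [xyz|xyz] := leP (y + z) x; first by rewrite Wk_eq0// mul0r.
have xsE : xstar x y z = y + z - x by rewrite xstarE// ltW.
have xs0 : 0 < xstar x y z by rewrite xsE subr_gt0.
set xs := xstar x y z in xsE xs0.
have D : Delta phi x y z <= phi xs.
  rewrite /Delta -/xs; have := testf_nincr (ltW m_gt0) zx.
  have := testf_ge0 m y; lra.
apply: (@le_trans _ _ (Wk hphi x y z * phi xs)).
  by rewrite ler_wpM2l// Wk_ge0.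
have [big|small] := leP 1 (m * xs); first by rewrite testf_eq0// mulr0.
have p1 : phi xs <= 1 by rewrite testf_le1// ltW.
apply: (@le_trans _ _ (Wk hphi x y z)); first by rewrite ler_piMr// Wk_ge0.
(* [a] and [b] are the smaller and the larger of [y] and [z]. From [8 * 4 = 32] and
   [sqrt x <= 2 * sqrt b] comes the constant [64], times [sqrt (xs / a)]. *)
have gen a b : 0 < a -> 0 < b -> a <= b -> b <= x -> x <= a + b -> xs <= a ->
    x * y * z = x * a * b -> 2 * x + y + z <= 4 * x ->
    Wk hphi x y z <= 64 * b0 ^+ 2 * errf a.
  move=> a0 b_0 ab bx xab xsa E le4.
  apply: (le_trans (Wk_le_sqr (L := Num.sqrt xs) chphi hphi_ge0 hphi_le hphi_ler x0 y0 z0 xs0 _)).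
    by rewrite !inE eqxx !orbT.
  rewrite E.
  have sa : 0 < Num.sqrt a by rewrite sqrtr_gt0.
  have sb : 0 < Num.sqrt b by rewrite sqrtr_gt0.
  have sx : 0 < Num.sqrt x by rewrite sqrtr_gt0.
  have hx : Num.sqrt x <= 2 * Num.sqrt b.
    rewrite -[X in _ <= X * _]ger0_norm// -sqrtr_sqr -sqrtrM ?sqr_ge0// ler_wsqrtr//; lra.
  apply: (@le_trans _ _ (64 * b0 ^+ 2 * (Num.sqrt xs / Num.sqrt a))).
    rewrite (sqrtrM _ (mulr_ge0 (ltW x0) (ltW a0))) (sqrtrM _ (ltW x0)) ler_pdivrMr ?mulr_gt0//.
    have -> : 64 * b0 ^+ 2 * (Num.sqrt xs / Num.sqrt a) *
      (Num.sqrt x * Num.sqrt a * Num.sqrt b) =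
      Num.sqrt xs * (8 * b0 ^+ 2 * (8 * Num.sqrt x * Num.sqrt b)).
      by field; rewrite gt_eqF.
    rewrite ler_wpM2l ?sqrtr_ge0// ler_wpM2l//; first by nonneg.
    apply: (le_trans le4); have := sqr_sqrtr (ltW x0); nra.
  rewrite ler_wpM2l//; first by nonneg.
  rewrite /errf a0 le_min; apply/andP; split.
    by rewrite ler_pdivrMr// mul1r ler_wsqrtr.
  rewrite (sqrtrM _ (ltW m_gt0)) invfM ler_wpM2r ?invr_ge0 ?(ltW sa)//.
  have sm : 0 < Num.sqrt m by rewrite sqrtr_gt0.
  rewrite -[leRHS]mul1r ler_pdivlMr// mulrC -(sqrtrM _ (ltW m_gt0)).
  by rewrite -sqrtr1 ler_wsqrtr// ltW.
have ey := errf_ge0 y; have ez := errf_ge0 z.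
have [yz|zy] := leP y z.
  apply: (le_trans (gen y z _ _ _ _ _ _ _ _)) => //; try lra.
  by rewrite ler_wpM2l ?lerDl//; nonneg.
apply: (le_trans (gen z y _ _ _ _ _ _ _ _)) => //; try lra.
by rewrite ler_wpM2l ?lerDr//; nonneg.
Qed.

Definition Ksym (x y z : R) : R :=
  Kk hphi phi x y z + Kk hphi phi x z y + Kk hphi phi y x z +
  Kk hphi phi y z x + Kk hphi phi z x y + Kk hphi phi z y x.

(** Two gain and loss pairs at [40] each, and two terms with [c] first at [64] each. The pairs
    produce [phi a] only, but the right side is kept symmetric so that the bound transfers to every
    ordering. *)
Lemma Ksym_sorted (a b c : R) : 0 <= a -> a <= b -> b <= c ->
  Ksym a b c <= 80 * b0 ^+ 2 * (1 + q1) * (phi a + phi b + phi c) +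
    128 * b0 ^+ 2 * (errf a + errf b + errf c).
Proof.
move=> a0 ab bc; have b2 := sqr_ge0 b0.
have pa := testf_ge0 m a; have pb := testf_ge0 m b; have pc := testf_ge0 m c.
have t1 := @Kk_max_first_le c a b ltac:(lra) ltac:(lra) ltac:(lra) ltac:(lra).
have t2 := @Kk_max_first_le c b a ltac:(lra) ltac:(lra) ltac:(lra) ltac:(lra).
have e0 : 0 <= b0 ^+ 2 * errf c by rewrite mulr_ge0// errf_ge0.
have e1 : 0 <= b0 ^+ 2 * (1 + q1) * (phi b + phi c) by nonneg.
have e2 : 0 <= b0 ^+ 2 * (1 + q1) * phi a by nonneg.
suff : Kk hphi phi a b c + Kk hphi phi b a c <= 40 * b0 ^+ 2 * (1 + q1) * phi a /\
       Kk hphi phi a c b + Kk hphi phi b c a <= 40 * b0 ^+ 2 * (1 + q1) * phi a.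
  by rewrite /Ksym => -[h1 h2]; lra.
(* If [b = 0], two entries vanish and the kernel is [0] by its last clause. *)
have [b_0|b_0] := leP b 0.
  have -> : b = a by lra.
  have -> : a = 0 by lra.
  rewrite /Kk (_ : Wk hphi 0 0 c = 0); last by rewrite /Wk/= !(mulr0, mul0r) !ltxx !(andbF, andFb).
  rewrite (_ : Wk hphi 0 c 0 = 0); last by rewrite /Wk/= !(mulr0, mul0r) !ltxx !(andbF, andFb).
  rewrite !mul0r addr0; split; nonneg.
have [w1 w2 w3 w4] := Wk_le4 a0 ab b_0 bc.
have W0 x y z : 0 <= Wk hphi x y z by exact: Wk_ge0.
split.
- apply: (@gain_loss_le a b c) => //.
  + by move=> bc4; have [] := Wk_compare a0 ab b_0 bc4.
  + by rewrite /Delta xstarE; lra.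
  + by rewrite /Delta xstarE; lra.
- apply: (@gain_loss_le a b c) => //.
  + by move=> bc4; have [] := Wk_compare a0 ab b_0 bc4.
  + by rewrite /Delta xstarE; [rewrite (addrC c b); lra|lra].
  + by rewrite /Delta xstarE; [rewrite (addrC c a); lra|lra].
Qed.

Lemma Ksym_le (x y z : R) : 0 <= x -> 0 <= y -> 0 <= z ->
  Ksym x y z <= 80 * b0 ^+ 2 * (1 + q1) * (phi x + phi y + phi z) +
    128 * b0 ^+ 2 * (errf x + errf y + errf z).
Proof.
move=> x0 y0 z0.
have [xy|/ltW yx] := leP x y; have [yz|/ltW zy] := leP y z; have [xz|/ltW zx] := leP x z.
- exact: Ksym_sorted.
- exact: Ksym_sorted.
- by have := Ksym_sorted x0 xz zy; rewrite /Ksym; lra.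
- by have := Ksym_sorted z0 zx xy; rewrite /Ksym; lra.
- by have := Ksym_sorted y0 yx xz; rewrite /Ksym; lra.
- by have := Ksym_sorted y0 yz zx; rewrite /Ksym; lra.
- by have := Ksym_sorted z0 zy yx; rewrite /Ksym; lra.
- by have := Ksym_sorted z0 zy yx; rewrite /Ksym; lra.
Qed.

End cubic_bound.

(** * Finite measures, one-sided integral bounds and triple products *)

Section finite_measure_of_measure.
Context {R : realType} (G : {measure set R -> \bar R}).

(** A copy of [G] indexed by the proof of finiteness, to which the finite measure structure can be
    attached. *)
Definition fmeas (fG : fin_num_fun G) : set R -> \bar R := G.

Hypothesis fG : fin_num_fun G.

HB.instance Definition _ := Measure.copy (fmeas fG) G.
HB.instance Definition _ := Measure_isFinite.Build _ _ _ (fmeas fG) fG.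

End finite_measure_of_measure.

Section integral_upper_bound.
Local Open Scope ereal_scope.
Context d (T : measurableType d) (R : realType).
Variable mu : {measure set T -> \bar R}.

(* No measurability: the integral of a nonnegative function is a supremum over
   simple functions. *)
Lemma le_integral_nonmeas (D : set T) (f g : T -> \bar R) :
  (forall x, D x -> f x <= g x) -> (forall x, D x -> 0 <= g x) ->
  \int[mu]_(x in D) f x <= \int[mu]_(x in D) g x.
Proof.
move=> fg g0; rewrite [leLHS]integralE.
apply: (@le_trans _ _ (\int[mu]_(x in D) f^\+ x)).
  by rewrite -[leRHS]adde0 leeD2l// oppe_le0 integral_ge0.
rewrite !ge0_integralE//; apply: le_ereal_sup => _ [h /= hf <-].
exists h => // x; apply: (le_trans (hf x)).
rewrite !patchE; case: ifPn => //; rewrite inE => Dx.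
by rewrite funeposE ge_max fg// g0.
Qed.

(* Both parts are finite because [+oo - +oo = -oo] in the extended reals. *)
Lemma integral_fin_num_integrable (D : set T) (f : T -> \bar R) : measurable D ->
  measurable_fun D f -> \int[mu]_(x in D) f x \is a fin_num ->
  mu.-integrable D f.
Proof.
move=> mD mf; rewrite integralE => ff; apply/integrableP; split => //.
have p0 : 0 <= \int[mu]_(x in D) f^\+ x by exact: integral_ge0.
have n0 : 0 <= \int[mu]_(x in D) f^\- x by exact: integral_ge0.
have [pf nf] : \int[mu]_(x in D) f^\+ x \is a fin_num /\
               \int[mu]_(x in D) f^\- x \is a fin_num.
  move: ff p0 n0; set P := integral _ _ _; set Q := integral _ _ _.
  by case: P => [?| |]; case: Q => [?| |].
rewrite (eq_integral (fun x => f^\+ x + f^\- x)); last first.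
  by move=> x _; rewrite -[LHS]/((abse \o f) x) fune_abse.
rewrite ge0_integralD//; [|exact: measurable_funepos|exact: measurable_funeneg].
by apply: lte_add_pinfty; rewrite -ge0_fin_numE.
Qed.

End integral_upper_bound.

Section triple_product.
Local Open Scope ereal_scope.
Context {R : realType} (G : {finite_measure set R -> \bar R}).

(* Copies of the product measures, because the canonical finite-measure structure
   of [\x] is attached to products of subprobabilities only. *)
Definition prod2 : set (R * R) -> \bar R := G \x G.

HB.instance Definition _ := Measure.copy prod2 (G \x G).

Lemma prod2_setT : prod2 setT = G setT * G setT.
Proof. by rewrite -setXTT /prod2 product_measure1E. Qed.

Lemma prod2_fin_num : fin_num_fun prod2.
Proof.
move=> A mA; rewrite ge0_fin_numE//.
apply: (@le_lt_trans _ _ (prod2 setT)).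
  by apply: le_measure; rewrite ?inE.
by rewrite prod2_setT lte_mul_pinfty// ?fin_num_measure// ltey_eq fin_num_measure.
Qed.

HB.instance Definition _ := Measure_isFinite.Build _ _ _ prod2 prod2_fin_num.

Definition prod3 : set (R * R * R) -> \bar R := prod2 \x G.

HB.instance Definition _ := Measure.copy prod3 (prod2 \x G).

Lemma prod3_fin_num : fin_num_fun prod3.
Proof.
move=> A mA; rewrite ge0_fin_numE//.
apply: (@le_lt_trans _ _ (prod3 setT)).
  by apply: le_measure; rewrite ?inE.
rewrite -setXTT /prod3 product_measure1E//.
by rewrite lte_mul_pinfty// ?fin_num_measure// ltey_eq fin_num_measure.
Qed.

HB.instance Definition _ := Measure_isFinite.Build _ _ _ prod3 prod3_fin_num.

Section ge0.
Variable f : R * R * R -> \bar R.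
Hypotheses (mf : measurable_fun setT f) (f0 : forall p, 0 <= f p).

Lemma integral_prod3 :
  \int[prod3]_p f p = \int[G]_x \int[G]_y \int[G]_z f (x, y, z).
Proof.
rewrite /prod3 fubini_tonelli1//.
have mF : measurable_fun setT (fubini_F G f) by exact: measurable_fun_fubini_tonelli_F.
rewrite -[LHS]/(\int[G \x G]_x fubini_F G f x) fubini_tonelli1//.
by move=> p; apply: integral_ge0.
Qed.

End ge0.

(** The transpositions [swap12] and [swap23] generate all permutations of the coordinates. *)
Definition swap12 (p : R * R * R) : R * R * R := (p.1.2, p.1.1, p.2).
Definition swap23 (p : R * R * R) : R * R * R := (p.1.1, p.2, p.1.2).

Lemma measurable_swap12 : measurable_fun setT swap12.
Proof.
apply/measurable_fun_pair; last exact: measurable_snd.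
by apply/measurable_fun_pair; exact: measurableT_comp.
Qed.

Lemma measurable_swap23 : measurable_fun setT swap23.
Proof.
apply/measurable_fun_pair; last exact: measurableT_comp.
by apply/measurable_fun_pair; [exact: measurableT_comp|exact: measurable_snd].
Qed.

Lemma ge0_integral_swap12 (f : R * R * R -> \bar R) : measurable_fun setT f ->
  (forall p, 0 <= f p) -> \int[prod3]_p f (swap12 p) = \int[prod3]_p f p.
Proof.
move=> mf f0; rewrite [RHS]integral_prod3//.
transitivity (\int[G]_x \int[G]_y \int[G]_z f (y, x, z)).
  rewrite (@integral_prod3 (f \o swap12))//; last by move=> p; exact: f0.
  exact: measurableT_comp mf measurable_swap12.
have mF : measurable_fun setT (fubini_F G f) by exact: measurable_fun_fubini_tonelli_F.
rewrite (fubini_tonelli (fun q => \int[G]_z f (q.2, q.1, z)))//.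
- apply: (measurableT_comp mF (g := fun q : R * R => (q.2, q.1))).
  by apply/measurable_fun_pair.
- by move=> q; exact: integral_ge0.
Qed.

Lemma ge0_integral_swap23 (f : R * R * R -> \bar R) : measurable_fun setT f ->
  (forall p, 0 <= f p) -> \int[prod3]_p f (swap23 p) = \int[prod3]_p f p.
Proof.
move=> mf f0; rewrite [RHS]integral_prod3//.
transitivity (\int[G]_x \int[G]_y \int[G]_z f (x, z, y)).
  rewrite (@integral_prod3 (f \o swap23))//; last by move=> p; exact: f0.
  exact: measurableT_comp mf measurable_swap23.
apply: eq_integral => x _.
rewrite (fubini_tonelli (fun q => f (x, q.2, q.1)))//.
apply: (measurableT_comp mf (g := fun q : R * R => (x, q.2, q.1))).
by apply/measurable_fun_pair => //; apply/measurable_fun_pair.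
Qed.

(** Invariance is tested on nonnegative functions, where Tonelli's theorem applies and compositions
    are immediate; signed functions follow from their positive and negative parts. *)
Definition preserving (s : R * R * R -> R * R * R) :=
  measurable_fun setT s /\ forall f : R * R * R -> \bar R, measurable_fun setT f ->
    (forall p, 0 <= f p) -> \int[prod3]_p f (s p) = \int[prod3]_p f p.

Lemma preserving_comp s t : preserving s -> preserving t -> preserving (s \o t).
Proof.
move=> [ms ps] [mt pt]; split; first exact: measurableT_comp.
move=> f mf f0; rewrite -(ps f)// -(pt (f \o s))//; last by move=> p; exact: f0.
exact: measurableT_comp.
Qed.

Lemma preserving_swap12 : preserving swap12.
Proof. by split; [exact: measurable_swap12|exact: ge0_integral_swap12]. Qed.

Lemma preserving_swap23 : preserving swap23.
Proof. by split; [exact: measurable_swap23|exact: ge0_integral_swap23]. Qed.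

Lemma integrable_preserving s (f : R * R * R -> R) : preserving s ->
  prod3.-integrable setT (EFin \o f) -> prod3.-integrable setT (EFin \o (f \o s)).
Proof.
move=> [ms ps] /integrableP[mf ff]; apply/integrableP; split.
  exact: measurableT_comp mf ms.
by rewrite (ps (fun p => `|(f p)%:E|))//; exact: measurableT_comp.
Qed.

Lemma Rintegral_preserving s (f : R * R * R -> R) : preserving s ->
  measurable_fun setT f ->
  Rintegral prod3 setT (f \o s) = Rintegral prod3 setT f.
Proof.
move=> [ms ps] mf; rewrite /Rintegral; congr fine.
rewrite integralE [in RHS]integralE.
have mf' : measurable_fun setT (EFin \o f) by exact/measurable_EFinP.
have hp := ps _ (measurable_funepos mf') (fun p => funepos_ge0 (EFin \o f) p).
have hn := ps _ (measurable_funeneg mf') (fun p => funeneg_ge0 (EFin \o f) p).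
rewrite -hp -hn.
by congr (_ - _); apply: eq_integral => p _; rewrite ?funeposE ?funenegE.
Qed.

Lemma Rintegral_third (psi : R -> R) : measurable_fun setT psi ->
  (forall x, 0 <= psi x)%R -> \int[G]_z (psi z)%:E \is a fin_num ->
  Rintegral prod3 setT (fun p => psi p.2) =
  (fine (G setT) ^+ 2 * Rintegral G setT psi)%R.
Proof.
move=> mpsi psi0 ff; rewrite /Rintegral.
rewrite (@integral_prod3 (fun p => (psi p.2)%:E)).
- transitivity (fine (\int[G]_x cst (\int[G]_z (psi z)%:E * G setT) x)).
    congr fine; apply: eq_integral => x _.
    by rewrite /cst /= -(@integral_cst _ _ _ G setT measurableT).
  rewrite integral_cst// fineM ?fin_numM ?fin_num_measure//.
  by rewrite fineM ?fin_num_measure//; ring.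
- by apply/measurable_EFinP; exact: measurableT_comp.
- by move=> p; rewrite lee_fin.
Qed.


Lemma bounded_prod3_integrable (f : R * R * R -> R) (M : R) :
  measurable_fun setT f -> (forall p, 0 <= f p <= M)%R ->
  prod3.-integrable setT (EFin \o f).
Proof.
move=> mf fM; apply: measurable_bounded_integrable => //.
  by rewrite -ge0_fin_numE// fin_num_measure.
exists M; split; first exact: num_real.
move=> x Mx p _ /=; have /andP[f0 f1] := fM p.
by rewrite ger0_norm// (le_trans f1)// ltW.
Qed.

Lemma Rintegral_sum3 (psi : R -> R) (M : R) : measurable_fun setT psi ->
  (forall x, 0 <= psi x <= M)%R ->
  Rintegral prod3 setT (fun p => psi p.1.1 + psi p.1.2 + psi p.2)%R =
  (3 * (fine (G setT) ^+ 2 * Rintegral G setT psi))%R.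
Proof.
move=> mpsi psiM.
have mpi3 : measurable_fun setT (fun p : R * R * R => psi p.2) by exact: measurableT_comp.
have mpi1 : measurable_fun setT (fun p : R * R * R => psi p.1.1).
  by apply: measurableT_comp => //; exact: measurableT_comp.
have mpi2 : measurable_fun setT (fun p : R * R * R => psi p.1.2).
  by apply: measurableT_comp => //; exact: measurableT_comp.
have b1 (p : R * R * R) := psiM p.1.1; have b2 (p : R * R * R) := psiM p.1.2.
have b3 (p : R * R * R) := psiM p.2.
have i1 := bounded_prod3_integrable mpi1 b1.
have i2 := bounded_prod3_integrable mpi2 b2.
have i3 := bounded_prod3_integrable mpi3 b3.
have ff : \int[G]_z (psi z)%:E \is a fin_num.
  rewrite ge0_fin_numE; last by apply: integral_ge0 => x _; rewrite lee_fin; have /andP[] := psiM x.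
  apply: (@le_lt_trans _ _ (\int[G]_z cst M%:E z)).
    apply: le_integral_nonmeas => x _; have /andP[p0 p1] := psiM x; rewrite lee_fin//.
    exact: le_trans p1.
  rewrite integral_cst// -[X in _ * X]fineK ?fin_num_measure//.
  by rewrite -EFinM ltry.
have e3 := @Rintegral_third psi mpsi (fun x => proj1 (andP (psiM x))) ff.
have e2 : Rintegral prod3 setT (fun p => psi p.1.2) = Rintegral prod3 setT (fun p => psi p.2).
  by rewrite -(Rintegral_preserving preserving_swap23 mpi3).
have e1 : Rintegral prod3 setT (fun p => psi p.1.1) = Rintegral prod3 setT (fun p => psi p.2).
  by rewrite -e2 -(Rintegral_preserving preserving_swap12 mpi2).
rewrite RintegralD//; last exact: (integrableD measurableT i1 i2).
by rewrite RintegralD// e1 e2 e3; ring.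
Qed.

End triple_product.

(** * Upper bound for the right-hand side of the weak equation *)

Section collision_bound.
Context {R : realType}.
Variables (hphi : R -> R) (b0 q1 : R).
Hypothesis chphi : continuous hphi.
Hypothesis hphi_ge0 : forall r, 0 <= hphi r.
Hypothesis hphi_le : forall r, hphi r <= b0.
Hypothesis hphi_ler : forall r, 0 <= r -> hphi r <= b0 * r.
Hypothesis q1_ge0 : 0 <= q1.
Hypothesis hphi_scale : forall rho r r', 1 <= rho <= Num.sqrt 2 ->
  0 <= r -> r <= r' -> r' <= rho * r ->
  hphi r' <= Num.sqrt (1 + q1 * (rho - 1)) * hphi r.
Variable m : R.
Hypothesis m_gt0 : 0 < m.
Notation phi := (testf m).
Notation mu := (@lebesgue_measure R).

Lemma measurable_testf : measurable_fun setT phi.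
Proof. by apply: continuous_measurable_fun; exact: testf_continuous. Qed.

Lemma measurable_errf : measurable_fun setT (errf m).
Proof.
rewrite /errf; apply: measurable_fun_ifT => //.
  exact: measurable_fun_ltr.
apply: measurable_minr => //; apply: measurable_fun_inv.
by apply: measurable_fun_sqrt; exact: measurable_funM.
Qed.

Lemma measurable_Kk : measurable_fun setT (fun p : R * R * R =>
  Kk hphi phi p.1.1 p.1.2 p.2).
Proof.
have m1 : measurable_fun setT (fun p : R * R * R => p.1.1) by exact: measurableT_comp.
have m2 : measurable_fun setT (fun p : R * R * R => p.1.2) by exact: measurableT_comp.
have m3 : measurable_fun setT (fun p : R * R * R => p.2) by exact: measurable_snd.
have mphi (f : R * R * R -> R) : measurable_fun setT f -> measurable_fun setT (phi \o f).
  by move=> mf; apply: measurableT_comp => //; exact: measurable_testf.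
apply: measurable_funM; first exact: measurable_Wk.
apply: measurable_funB; last exact: mphi.
apply: measurable_funB; last exact: mphi.
apply: measurable_funD; first exact: mphi.
apply: (mphi (fun p => xstar p.1.1 p.1.2 p.2)).
rewrite /xstar; apply: measurable_maxr => //; apply: measurable_funB => //.
exact: measurable_funD.
Qed.

Lemma testf_le_indic x : 0 <= x -> phi x <= \1_(`[0, m^-1]%classic) x.
Proof.
move=> x0; rewrite indicE mem_setE in_itv/= x0/=.
have [xm|xm] := leP x m^-1; first by rewrite testf_le1// ltW.
by rewrite testf_eq0// -ler_pdivrMl// mulr1 ltW.
Qed.

(** [Delta] is at most the sum of the indicators of [x <= 1 / m] and of [xstar <= 1 / m], two sets
    of length at most [1 / m]. With [W * sqrt x <= 16 * b0^2] and the prefactor [1 / 2], this adds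
    up to [16 * b0^2 / m]. *)
Lemma Jk_le (y z : R) : 0 <= y -> 0 <= z ->
  (Jk hphi phi y z <= (16 * b0 ^+ 2 / m)%:E)%E.
Proof.
move=> y0 z0; rewrite /Jk; set I : set R := `[0, y + z]%classic.
have b2 := sqr_ge0 b0.
pose A : set R := `[0, m^-1]%classic.
pose B : set R := `[y + z - m^-1, y + z]%classic.
pose g x : \bar R := ((16 * b0 ^+ 2)%:E * ((\1_A x)%:E + (\1_B x)%:E))%E.
have g0 x : (0 <= g x)%E.
  apply: mule_ge0; first by rewrite lee_fin; exact: mulr_ge0.
  by apply: adde_ge0; rewrite lee_fin.
apply: (@le_trans _ _ ((2^-1)%:E * \int[mu]_(x in I) g x)%E).
  rewrite lee_pmul2l ?lte_fin ?invr_gt0//.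
  apply: le_integral_nonmeas => // x; rewrite /I /= in_itv/= => /andP[x0 xyz].
  rewrite /g -EFinD -EFinM lee_fin /Kk mulrAC.
  have W0 : 0 <= Wk hphi x y z * Num.sqrt x by rewrite mulr_ge0 ?Wk_ge0 ?sqrtr_ge0.
  have W1 := Wk_sqrt_le chphi hphi_ge0 hphi_le hphi_ler x0 y0 z0 xyz.
  have xsE : xstar x y z = y + z - x by rewrite xstarE.
  have hA := testf_le_indic x0.
  have hB : phi (y + z - x) <= \1_B x.
    have := @testf_le_indic (y + z - x); rewrite subr_ge0 => /(_ xyz) h.
    apply: (le_trans h); rewrite !indicE !mem_setE !in_itv/= subr_ge0 xyz/= andbT.
    have -> // : (y + z - x <= m^-1) = (y + z - m^-1 <= x) by rewrite !lerBlDr [x + _]addrC.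
  have D : Delta phi x y z <= \1_A x + \1_B x.
    rewrite /Delta xsE; have := testf_ge0 m y; have := testf_ge0 m z.
    rewrite /A; lra.
  apply: (@le_trans _ _ (Wk hphi x y z * Num.sqrt x * (\1_A x + \1_B x))).
    by rewrite ler_wpM2l.
  by rewrite ler_wpM2r// addr_ge0.
have mI : measurable I by exact: measurable_itv.
have mA : measurable A by exact: measurable_itv.
have mB : measurable B by exact: measurable_itv.
have muA : (mu (A `&` I) <= (m^-1)%:E)%E.
  apply: (@le_trans _ _ (mu A)).
    by apply: le_measure; rewrite ?inE//; exact: measurableI.
  by rewrite lebesgue_measure_itvcc invr_gt0 m_gt0 subr0.
have muB : (mu (B `&` I) <= (m^-1)%:E)%E.
  apply: (@le_trans _ _ (mu B)).
    by apply: le_measure; rewrite ?inE//; exact: measurableI.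
  rewrite lebesgue_measure_itvcc lee_fin; case: ifP => _; last by rewrite invr_ge0 ltW.
  by rewrite opprB addrC subrK.
have -> : (\int[mu]_(x in I) g x)%E =
  ((16 * b0 ^+ 2)%:E * (mu (A `&` I) + mu (B `&` I)))%E.
  rewrite /g ge0_integralZl//=; last 3 first.
  - apply: emeasurable_funD; apply/measurable_EFinP; exact: measurable_indic.
  - by move=> x _; rewrite adde_ge0// lee_fin.
  - by rewrite lee_fin; exact: mulr_ge0.
  rewrite ge0_integralD//=; first by rewrite !integral_indic.
  - by apply/measurable_EFinP; exact: measurable_indic.
  - by apply/measurable_EFinP; exact: measurable_indic.
rewrite muleA -EFinM.
have c0 : 0 <= 2^-1 * (16 * b0 ^+ 2) by apply: mulr_ge0 => //; exact: mulr_ge0.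
apply: (@le_trans _ _ ((2^-1 * (16 * b0 ^+ 2))%:E * ((m^-1)%:E + (m^-1)%:E))%E).
  by rewrite lee_wpmul2l ?lee_fin// leeD.
by rewrite -EFinD -EFinM lee_fin; lra.
Qed.

Variables (G : {measure set R -> \bar R}) (N : R).
Hypothesis GB : in_B1 G.
Hypothesis GN : Nmass G = N%:E.

Lemma mass_setT : G setT = N%:E.
Proof.
have [G0 _] := GB.
pose neg : set R := `]-oo, 0[%classic.
have -> : [set: R] = neg `|` @Rpos R.
  apply/seteqP; split => // x _; rewrite /Rpos /neg /=.
  by have [x0|x0] := ltP x 0; [left|right]; rewrite /= in_itv//= ?x0 ?andbT.
transitivity (G neg + G (@Rpos R))%E.
  apply: measureU; [exact: measurable_itv|exact: measurable_itv|].
  apply/seteqP; split => // x []; rewrite /neg /Rpos/= !in_itv/= andbT => h1 h2.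
  by have := lt_le_trans h1 h2; rewrite ltxx.
by rewrite [G neg]G0 add0e.
Qed.

Lemma mass_fin_num : fin_num_fun G.
Proof.
move=> A mA; rewrite ge0_fin_numE//.
apply: (@le_lt_trans _ _ (G setT)); last by rewrite mass_setT ltry.
by apply: le_measure; rewrite ?inE.
Qed.

Let H := fmeas mass_fin_num.

(** Extension by zero: the weak equation integrates over [Rpos], while the symmetrisation is carried
    out on the whole space. *)
Definition posf (f : R -> R) (x : R) : R := if 0 <= x then f x else 0.

Lemma pairing_posf (f : R -> R) : pairing f G = Rintegral H setT (posf f).
Proof.
rewrite /pairing -[RHS]/(fine (\int[G]_x (posf f x)%:E)%E) integral_mkcond; congr fine.
apply: eq_integral => x _; rewrite /posf patchE /Rpos mem_setE in_itv/= andbT.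
by case: ifP.
Qed.

Lemma measurable_posf (f : R -> R) : measurable_fun setT f ->
  measurable_fun setT (posf f).
Proof. by move=> mf; apply: measurable_fun_ifT => //; exact: measurable_fun_ler. Qed.

Definition posK (p : R * R * R) : R :=
  if (0 <= p.1.1) && (0 <= p.1.2) && (0 <= p.2) then
    Kk hphi phi p.1.1 p.1.2 p.2 else 0.

Lemma measurable_posK : measurable_fun setT posK.
Proof.
apply: measurable_fun_ifT => //; last exact: measurable_Kk.
apply: measurable_and; last exact: measurable_fun_ler.
by apply: measurable_and; apply: measurable_fun_ler => //; exact: measurableT_comp.
Qed.

Lemma integral_posK :
  (\int[(G \x G) \x G]_(p in (@Rpos R `*` @Rpos R) `*` @Rpos R)
       (Kk hphi phi p.1.1 p.1.2 p.2)%:E = \int[prod3 H]_p (posK p)%:E)%E.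
Proof.
rewrite -[LHS]/(\int[prod3 H]_(p in (@Rpos R `*` @Rpos R) `*` @Rpos R)
       (Kk hphi phi p.1.1 p.1.2 p.2)%:E)%E.
rewrite integral_mkcond; apply: eq_integral => -[[x y] z] _.
rewrite patchE /posK /=.
have -> : ((x, y, z) \in (@Rpos R `*` @Rpos R) `*` @Rpos R) =
   (0 <= x) && (0 <= y) && (0 <= z).
  apply/idP/idP.
    by rewrite inE /Rpos => -[[]]/=; rewrite !in_itv/= !andbT => -> -> ->.
  move=> /andP[/andP[x0 y0] z0]; rewrite inE /Rpos.
  by split; [split|]; rewrite /= in_itv/= andbT.
by case: ifP.
Qed.

Lemma fine_HsetT : fine (H setT) = N.
Proof. by rewrite -[H setT]/(G setT) mass_setT. Qed.

Lemma quadratic_bound :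
  (\int[G \x G]_(p in @Rpos R `*` @Rpos R) Jk hphi phi p.1 p.2 <=
   (16 * b0 ^+ 2 / m * N ^+ 2)%:E)%E.
Proof.
have b2 := sqr_ge0 b0.
have N0 : 0 <= N by rewrite -lee_fin -mass_setT measure_ge0.
rewrite -[leLHS]/(\int[prod2 H]_(p in @Rpos R `*` @Rpos R) Jk hphi phi p.1 p.2)%E.
have c0 : 0 <= 16 * b0 ^+ 2 / m by apply: divr_ge0; [exact: mulr_ge0|exact: ltW].
apply: (@le_trans _ _ (\int[prod2 H]_(p in @Rpos R `*` @Rpos R) (cst (16 * b0 ^+ 2 / m)%:E p))%E).
  apply: le_integral_nonmeas => [[y z]|p _]; last by rewrite lee_fin.
  by rewrite /Rpos => -[/=]; rewrite !in_itv/= !andbT => y0 z0; exact: Jk_le.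
rewrite integral_cst; last by apply: measurableX; exact: measurable_itv.
rewrite [X in (_ * X)%E](_ : _ = (N ^+ 2)%:E)//.
transitivity (H (@Rpos R) * H (@Rpos R))%E.
  by apply: product_measure1E; exact: measurable_itv.
by rewrite -[H (@Rpos R)]/(Nmass G) GN -EFinM.
Qed.

Lemma posf_bounds f x : (forall y, 0 <= y -> 0 <= f y <= 1) -> 0 <= posf f x <= 1.
Proof. by move=> h; rewrite /posf; case: ifP => [/h//|_]; rewrite lexx ler01. Qed.

(** Permuting coordinates preserves the integral, so it is one sixth of the integral of the
    symmetrised integrand; each sum over three coordinates integrates to [3 * N^2] times a pairing.
    Hence [80 * 3 / 6 = 40] and [128 * 3 / 6 = 64]. *)
Lemma cubic_bound : (prod3 H).-integrable setT (EFin \o posK) ->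
  Rintegral (prod3 H) setT posK <=
    40 * b0 ^+ 2 * (1 + q1) * N ^+ 2 * pairing phi G +
    64 * b0 ^+ 2 * N ^+ 2 * pairing (errf m) G.
Proof.
move=> iK.
have b2 := sqr_ge0 b0.
have p12 := preserving_swap12 H; have p23 := preserving_swap23 H.
have mK := measurable_posK.
pose s3 := swap23 \o @swap12 R; pose s4 := swap12 \o @swap23 R.
pose s5 := swap12 \o s3.
have q3 : preserving H s3 by exact: preserving_comp.
have q4 : preserving H s4 by exact: preserving_comp.
have q5 : preserving H s5 by exact: preserving_comp.
have i1 := integrable_preserving p23 iK.
have i2 := integrable_preserving p12 iK.
have i3 := integrable_preserving q3 iK.
have i4 := integrable_preserving q4 iK.
have i5 := integrable_preserving q5 iK.
have j1 := integrableD measurableT iK i1.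
have j2 := integrableD measurableT j1 i2.
have j3 := integrableD measurableT j2 i3.
have j4 := integrableD measurableT j3 i4.
have j5 := integrableD measurableT j4 i5.
pose K6 p := posK p + posK (swap23 p) + posK (swap12 p) + posK (s3 p) +
  posK (s4 p) + posK (s5 p).
have e : Rintegral (prod3 H) setT K6 = 6 * Rintegral (prod3 H) setT posK.
  rewrite /K6 RintegralD// RintegralD// RintegralD// RintegralD// RintegralD//.
  rewrite (Rintegral_preserving p23 mK) (Rintegral_preserving p12 mK).
  rewrite (Rintegral_preserving q3 mK) (Rintegral_preserving q4 mK).
  rewrite (Rintegral_preserving q5 mK); lra.
pose C1 := 80 * b0 ^+ 2 * (1 + q1); pose C2 := 128 * b0 ^+ 2.
have C10 : 0 <= C1 by rewrite /C1; apply: mulr_ge0; [exact: mulr_ge0|exact: addr_ge0].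
have C20 : 0 <= C2 by exact: mulr_ge0.
have bphi x : 0 <= posf phi x <= 1.
  by apply: posf_bounds => y y0; rewrite testf_ge0 testf_le1// ltW.
have berr x : 0 <= posf (errf m) x <= 1.
  by apply: posf_bounds => y y0; rewrite errf_ge0 errf_le1.
have mphi := measurable_posf measurable_testf.
have merr := measurable_posf measurable_errf.
pose S (psi : R -> R) (p : R * R * R) := psi p.1.1 + psi p.1.2 + psi p.2.
have mS psi : measurable_fun setT psi -> measurable_fun setT (S psi).
  move=> mp; apply: measurable_funD; last exact: measurableT_comp.
  apply: measurable_funD; apply: measurableT_comp => //; exact: measurableT_comp.
have bS psi : (forall x, 0 <= psi x <= 1) -> forall p, 0 <= S psi p <= 3.
  move=> h p; rewrite /S; have /andP[a1 a2] := h p.1.1; have /andP[a3 a4] := h p.1.2.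
  have /andP[a5 a6] := h p.2; lra.
have iS1 := bounded_prod3_integrable H (mS _ mphi) (bS _ bphi).
have iS2 := bounded_prod3_integrable H (mS _ merr) (bS _ berr).
have iC1 : (prod3 H).-integrable setT (EFin \o (fun p => C1 * S (posf phi) p)).
  apply: (@bounded_prod3_integrable _ _ _ (C1 * 3)).
    by apply: measurable_funM => //; exact: mS.
  move=> p; have /andP[a1 a2] := bS _ bphi p.
  by rewrite mulr_ge0//= ler_wpM2l.
have iC2 : (prod3 H).-integrable setT (EFin \o (fun p => C2 * S (posf (errf m)) p)).
  apply: (@bounded_prod3_integrable _ _ _ (C2 * 3)).
    by apply: measurable_funM => //; exact: mS.
  move=> p; have /andP[a1 a2] := bS _ berr p.
  by rewrite mulr_ge0//= ler_wpM2l.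
have le : Rintegral (prod3 H) setT K6 <=
   Rintegral (prod3 H) setT (fun p => C1 * S (posf phi) p + C2 * S (posf (errf m)) p).
  apply: le_Rintegral => //; first exact: (integrableD measurableT iC1 iC2).
  move=> [[x y] z] _; rewrite /K6 /posK /s5 /s4 /s3 /swap12 /swap23 /=.
  rewrite /S /=.
  have r0 : 0 <= C1 * (posf phi x + posf phi y + posf phi z) +
      C2 * (posf (errf m) x + posf (errf m) y + posf (errf m) z).
    have /andP[a1 a2] := bS _ bphi (x, y, z); have /andP[a3 a4] := bS _ berr (x, y, z).
    by apply: addr_ge0; apply: mulr_ge0.
  move: r0; rewrite /posf.
  (* If some coordinate is negative, all six terms vanish and the nonnegative right side
     suffices. *)
  have [x0|x0] := leP 0 x; have [y0|y0] := leP 0 y; have [z0|z0] := leP 0 z => /= r0;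
    try by rewrite (le_trans _ r0)// !addr0.
  have := Ksym_le chphi hphi_ge0 hphi_le hphi_ler q1_ge0 hphi_scale m_gt0 x0 y0 z0.
  by rewrite /Ksym.
move: le; rewrite e RintegralD// RintegralZl// RintegralZl//.
rewrite (Rintegral_sum3 H mphi bphi) (Rintegral_sum3 H merr berr) fine_HsetT.
rewrite !pairing_posf /C1 /C2; lra.
Qed.

(** A sum of extended reals that is a real number has finite terms. So the weak equation itself
    makes the cubic integral finite, and with it comes the integrability needed for the
    symmetrisation. *)
Lemma collision_rhs_le (d : R) : d%:E = collision_rhs hphi phi G ->
  d <= 16 * b0 ^+ 2 / m * N ^+ 2 +
    40 * b0 ^+ 2 * (1 + q1) * N ^+ 2 * pairing phi G +
    64 * b0 ^+ 2 * N ^+ 2 * pairing (errf m) G.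
Proof.
rewrite /collision_rhs integral_posK => dE.
have := quadratic_bound; move: dE; set J := (\int[_]_(_ in _) _)%E; set K := (\int[_]_p _)%E.
move=> dE hJ.
have Kfin : K \is a fin_num.
  by move: dE {hJ}; case: K => [?| |]//; case: J => [?| |].
have iK : (prod3 H).-integrable setT (EFin \o posK).
  apply: integral_fin_num_integrable => //.
  by apply/measurable_EFinP; exact: measurable_posK.
have := cubic_bound iK; rewrite /Rintegral -/K => hK.
rewrite -addrA -lee_fin dE EFinD; apply: leeD; first exact: hJ.
by rewrite -(fineK Kfin) lee_fin.
Qed.

End collision_bound.

(** * Derivatives relative to a set *)

Section deriv_within_lemmas.
Context {R : realType}.
Implicit Types (A : set R) (f : R -> R) (x l : R).

Lemma deriv_within_continuous A f (df : R -> R) :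
  (forall x, A x -> deriv_within A f x (df x)) -> {within A, continuous f}.
Proof.
move=> hf; apply/subspace_continuousP => x Ax.
have /cvgrPdist_le /(_ 1 ltr01) := hf x Ax.
rewrite !near_withinE => h.
apply/cvgrPdist_le => e e0; rewrite near_withinE.
(* Near [x] the difference quotient is within [1] of [df x], so this number is a Lipschitz constant
   at [x]. *)
have K0 : 0 < `|df x| + 1 by rewrite ltr_wpDl.
have h1 : \forall h \near (0 : R)^', A (x + h) -> `|df x - h^-1 * (f (x + h) - f x)| <= 1.
  exact: h.
have h2 : \forall h \near (0 : R)^', `|h| <= e / (`|df x| + 1).
  by apply: dnbhs0_le; exact: divr_gt0.
have : \forall h \near (0 : R)^', A (x + h) -> `|f x - f (x + h)| <= e.
  near=> u => Axu.
  have u0 : u != 0 by near: u; exact: nbhs_dnbhs_neq.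
  have k1 : `|df x - u^-1 * (f (x + u) - f x)| <= 1 by move: Axu; near: u.
  have k2 : `|u| <= e / (`|df x| + 1) by near: u.
  have -> : f x - f (x + u) = u * (df x - u^-1 * (f (x + u) - f x)) - u * df x by field.
  apply: (le_trans (ler_normB _ _)); rewrite !normrM -mulrDr addrC.
  apply: (@le_trans _ _ (`|u| * (`|df x| + 1))); first by rewrite ler_wpM2l// lerD2l.
  by rewrite -ler_pdivlMr.
rewrite /dnbhs near_withinE => h3.
have h4 : \forall u \near (0 : R), A (x + u) -> `|f x - f (x + u)| <= e.
  near=> u => Axu; have [->|u0] := eqVneq u 0.
    by rewrite addr0 subrr normr0 ltW.
  by move: u0 Axu; near: u.
have h5 : (fun y => y - x) @ nbhs x --> (0 : R).
  rewrite -(subrr x); apply: cvgB; [exact: cvg_id|exact: cvg_cst].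
have h6 : \forall y \near x, A (x + (y - x)) -> `|f x - f (x + (y - x))| <= e.
  exact: h5 _ h4.
near=> y => Ay.
have : A (x + (y - x)) -> `|f x - f (x + (y - x))| <= e by near: y.
by rewrite addrC subrK; exact.
Unshelve. all: by end_near.
Qed.

Lemma deriv_within_is_derive A f x l : nbhs x A -> deriv_within A f x l ->
  is_derive x 1 f l.
Proof.
move=> Ax hf.
have : (fun h : R => h^-1 *: ((f \o shift x) (h *: 1) - f x)) @ (0 : R)^' --> l.
  apply/cvgrPdist_le => e e0.
  have /cvgrPdist_le /(_ e e0) := hf; rewrite near_withinE => h1.
  have h2 : \forall h \near (0 : R)^', A (x + h).
    apply: nbhs_dnbhs.
    have h5 : (fun h => x + h) @ nbhs (0 : R) --> x.
      by rewrite -[X in _ --> X]addr0; apply: cvgD; [exact: cvg_cst|exact: cvg_id].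
    exact: h5 _ Ax.
  near=> h.
  have : `|l - h^-1 * (f (x + h) - f x)| <= e.
    have : A (x + h) by near: h.
    by near: h.
  by rewrite /= /shift /= [h *: 1]mulr1 [h + x]addrC.
move=> h; apply: DeriveDef; first by apply/cvg_ex; exists l.
exact: cvg_lim.
Unshelve. all: by end_near.
Qed.

End deriv_within_lemmas.

(** * Continuous extension of the profile to negative arguments *)

Section hphi_extension.
Context {R : realType}.
Variable hphi : R -> R.

(** The assumption says nothing about [hphi] on negative numbers. This extension, constant there, is
    continuous everywhere and leaves the kernel unchanged, since [PhiK] is only evaluated at
    nonnegative arguments in [Wk]. *)
Definition ext0 (r : R) : R := hphi (Num.max r 0).

Lemma ext0E r : 0 <= r -> ext0 r = hphi r.
Proof. by move=> r0; rewrite /ext0 max_l. Qed.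

Lemma continuous_ext0 : {within `[0, +oo[, continuous hphi} -> continuous ext0.
Proof.
move=> /subspace_continuousP ch x.
have max0 r : (`[0, +oo[%classic : set R) (Num.max r 0).
  by rewrite /= in_itv/= andbT le_max lexx orbT.
apply: (@cvg_comp _ _ _ (fun r => Num.max r 0) hphi _ _ _ _ (ch _ (max0 x))).
move=> P /= hP.
have hx : \forall r \near x, (`[0, +oo[%classic : set R) (Num.max r 0) -> P (Num.max r 0).
  exact: (@continuous_maxr0 R x _ hP).
suff : \forall r \near x, P (Num.max r 0) by [].
by apply: filterS hx => r Hr; exact: Hr (max0 r).
Qed.

Lemma Wk_ext0 (x y z : R) : Wk hphi x y z = Wk ext0 x y z.
Proof.
have PE u v : 0 <= u -> 0 <= v -> PhiK hphi u v = PhiK ext0 u v.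
  by move=> u0 v0; rewrite /PhiK !ext0E.
rewrite /Wk /=; case: ifP => _; last first.
  by repeat case: ifP => _ //; rewrite PE ?sqrtr_ge0.
congr (_ * _); apply: eq_Rintegral => s; rewrite inE/= in_itv/= => /andP[s1 _].
apply: eq_Rintegral => th _; apply: PE; apply: mulr_ge0; rewrite ?sqrtr_ge0 ?Ystar_ge0//.
by apply: le_trans s1; rewrite le_max normr_ge0.
Qed.

Lemma collision_rhs_ext0 phi G :
  collision_rhs hphi phi G = collision_rhs ext0 phi G.
Proof.
have -> : collision_rhs hphi phi = collision_rhs ext0 phi; last by [].
rewrite /collision_rhs /Jk /Kk.
have WE : Wk hphi = Wk ext0 by do 3! apply/funext => ?; exact: Wk_ext0.
by rewrite WE.
Qed.

End hphi_extension.

(** * Convergence of the pairings as [m] tends to infinity *)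

Section mass_at_zero.
Context {R : realType}.

(** Dominated convergence; the finite mass makes the constant [1] integrable. *)
Lemma pairing_cvg (G : {measure set R -> \bar R}) (N : R) (f_ : nat -> R -> R)
    (f : R -> R) : in_B1 G -> Nmass G = N%:E ->
  (forall n, measurable_fun setT (f_ n)) ->
  (forall n x, 0 <= x -> 0 <= f_ n x <= 1) ->
  (forall x, 0 <= x -> f_ n x @[n --> \oo] --> f x) ->
  pairing (f_ n) G @[n --> \oo] --> pairing f G.
Proof.
move=> GB GN mf bf cf.
have mR : measurable (@Rpos R) by exact: measurable_itv.
have Rp x : @Rpos R x -> 0 <= x by rewrite /Rpos /= in_itv/= andbT.
have iG : G.-integrable (@Rpos R) (cst 1%:E).
  apply/integrableP; split => //.
  rewrite (eq_integral (cst 1%:E)); last by move=> x _; rewrite /= normr1.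
  by rewrite integral_cst// mul1e -[G _]/(Nmass G) GN ltry.
have ff n : (\int[G]_(x in @Rpos R) (f_ n x)%:E)%E \is a fin_num.
  rewrite ge0_fin_numE; last by apply: integral_ge0 => x /Rp /(bf n)/andP[]; rewrite lee_fin.
  apply: (@le_lt_trans _ _ (\int[G]_(x in @Rpos R) (cst 1%:E x))%E).
    by apply: le_integral_nonmeas => x /Rp /(bf n)/andP[]; rewrite // lee_fin.
  by rewrite integral_cst// mul1e -[G _]/(Nmass G) GN ltry.
have f01 x : 0 <= x -> 0 <= f x <= 1.
  move=> x0; apply/andP; split.
    apply: (ler_cvg_to (cvg_cst 0) (cf x x0)).
    by apply: nearW => n; have /andP[] := bf n x x0.
  apply: (ler_cvg_to (cf x x0) (cvg_cst (1 : R))).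
  by apply: nearW => n; have /andP[] := bf n x x0.
have ff0 : (\int[G]_(x in @Rpos R) (f x)%:E)%E \is a fin_num.
  rewrite ge0_fin_numE; last by apply: integral_ge0 => x /Rp /f01/andP[]; rewrite lee_fin.
  apply: (@le_lt_trans _ _ (\int[G]_(x in @Rpos R) (cst 1%:E x))%E).
    by apply: le_integral_nonmeas => x /Rp /f01/andP[]; rewrite // lee_fin.
  by rewrite integral_cst// mul1e -[G _]/(Nmass G) GN ltry.
apply: fine_cvg; rewrite fineK//.
apply: (@dominated_cvg _ _ _ G _ mR (fun n x => (f_ n x)%:E) _ (cst 1%:E)) => //.
- by move=> n; apply/measurable_EFinP; exact: measurable_funTS.
- by move=> x /Rp x0; apply: cvg_EFin; [exact: nearW|exact: cf].
- by move=> n x /Rp /(bf n)/andP[f0 f1]; rewrite /= lee_fin ger0_norm.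
Qed.

Lemma testf_cvg (x : R) : 0 <= x ->
  testf n.+1%:R x @[n --> \oo] --> ((x == 0)%:R : R).
Proof.
rewrite le_eqVlt => /predU1P[<-|x0].
  rewrite eqxx; apply: cvg_near_cst; apply: nearW => n.
  by rewrite /testf mulr0 subr0 max_l// expr1n.
rewrite gt_eqF//; apply: cvg_near_cst.
near=> n; rewrite testf_eq0// -ler_pdivrMr// mul1r.
have : x^-1 <= n%:R by near: n; exact: nbhs_infty_ger.
by move/le_trans; apply; rewrite ler_nat.
Unshelve. all: by end_near.
Qed.

Lemma errf_cvg (x : R) : errf n.+1%:R x @[n --> \oo] --> (0 : R).
Proof.
have [x0|x0] := ltP 0 x; last first.
  rewrite (_ : (fun n => _) = fun=> 0); first exact: cvg_cst.
  by apply/funext => n; rewrite /errf ltNge x0.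
apply/cvgrPdist_le => e e0; near=> n.
have s0 : 0 < Num.sqrt (n.+1%:R * x) by rewrite sqrtr_gt0 mulr_gt0.
rewrite /errf x0.
rewrite sub0r normrN ger0_norm; last by rewrite le_min ler01 /= invr_ge0 ltW.
rewrite ge_min; apply/orP; right.
rewrite -[leRHS]invrK lef_pV2 ?posrE ?invr_gt0//.
rewrite -[leLHS]ger0_norm ?invr_ge0 ?(ltW e0)// -sqrtr_sqr ler_wsqrtr//.
rewrite -ler_pdivrMr//.
have : (e^-1) ^+ 2 / x <= n%:R by near: n; exact: nbhs_infty_ger.
by move/le_trans; apply; rewrite ler_nat.
Unshelve. all: by end_near.
Qed.

Lemma pairing_mass0 (G : {measure set R -> \bar R}) :
  pairing (fun x => (x == 0)%:R) G = fine (G [set 0]).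
Proof.
rewrite /pairing (eq_integral (fun x => (\1_[set (0 : R)] x)%:E)); last first.
  move=> x _; rewrite indicE.
  by have -> : (x \in [set (0 : R)]) = (x == 0) by apply/idP/eqP; rewrite inE.
rewrite integral_indic//; last exact: measurable_itv.
congr (fine (G _)); apply/seteqP; split => [x []//|x /= ->]; split => //.
by rewrite /Rpos /= in_itv/= lexx.
Qed.

End mass_at_zero.

(** * Gronwall's inequality with a vanishing error *)

Section gronwall.
Context {R : realType}.
Notation mu := (@lebesgue_measure R).

Lemma subitv_Rpos (T : R) : (`[0, T]%classic : set R) `<=` @Rpos R.
Proof. by move=> x; rewrite /Rpos /= !in_itv/= andbT => /andP[]. Qed.

Lemma gronwall_step (u du h : R -> R) (c T : R) : 0 < T -> 0 <= c ->
  (forall t, 0 <= t -> deriv_within (@Rpos R) u t (du t)) ->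
  {within @Rpos R, continuous du} ->
  {within `[0, T], continuous h} ->
  (forall t, 0 <= t <= T -> 0 <= h t) ->
  (forall t, 0 <= t <= T -> du t - c * u t <= h t) ->
  ((expR (- (c * T)) * u T - u 0)%:E <= \int[mu]_(t in `[0%R, T]) (h t)%:E)%E.
Proof.
move=> T0 c0 hu cdu ch h0 hle.
have cu : {within @Rpos R, continuous u}.
  by apply: (deriv_within_continuous (df := du)) => x; rewrite /Rpos /= in_itv/= andbT; exact: hu.
have cu' := continuous_subspaceW (@subitv_Rpos T) cu.
have cdu' := continuous_subspaceW (@subitv_Rpos T) cdu.
pose E t := expR (- (c * t)).
have dE (t : R) : is_derive t 1 E (- c * E t).
  by rewrite /E; apply: is_derive_eq; rewrite /GRing.scale/= mulr1; ring.
have cE : continuous E.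
  by move=> t; apply: differentiable_continuous; apply/derivable1_diffP; case: (dE t).
pose V t := E t * u t.
pose v t := E t * (du t - c * u t).
have dV (t : R) : t \in `]0, T[ -> is_derive t 1 V (v t).
  rewrite in_itv/= => /andP[t0 _].
  have du1 : is_derive t 1 u (du t).
    apply: (@deriv_within_is_derive _ (@Rpos R)); last exact/hu/ltW.
    by apply: filterS (lt_nbhsr t0) => y y0; rewrite /Rpos /= in_itv/= andbT ltW.
  apply: is_derive_eq; rewrite /GRing.scale/= /v; ring.
have cv : {within `[0, T], continuous v}.
  move=> t; apply: continuousM; first exact: continuous_subspaceT.
  apply: continuousB; first exact: cdu'.
  by apply: continuousM; [exact: cvg_cst|exact: cu'].
have cV : {within `[0, T], continuous V}.
  by move=> t; apply: continuousM; [exact: continuous_subspaceT|exact: cu'].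
have VE : ((V T)%:E - (V 0%R)%:E = \int[mu]_(t in `[0%R, T]) (v t)%:E)%E.
  apply/esym/continuous_FTC2 => //.
    have /(continuous_within_itvP _ T0)[_ a1 a2] := cV.
    by split => // t /dV[].
  by move=> t /dV [_ <-]; rewrite derive1E.
have V0 : V 0 = u 0 by rewrite /V /E mulr0 oppr0 expR0 mul1r.
have VT : V T = expR (- (c * T)) * u T by [].
rewrite EFinB -V0 -VT VE.
apply: le_integral_nonmeas => t; rewrite /= in_itv/= => tT; rewrite lee_fin; last exact: h0.
have E0 : 0 <= E t by exact: expR_ge0.
have E1 : E t <= 1.
  by rewrite /E -expR0 ler_expR oppr_le0 mulr_ge0//; case/andP: tT.
apply: (@le_trans _ _ (E t * h t)); first by rewrite ler_wpM2l// hle.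
by rewrite ler_piMl// h0.
Qed.

(** The positive part [h n] lies between [0] and [e n], so it inherits the bound [C] and the limit
    [0], while its continuity provides the measurability that dominated convergence requires. *)
Lemma gronwall_limit (u du : nat -> R -> R) (e : nat -> R -> R) (c C T : R)
    (uT u0 : R) : 0 < T -> 0 <= c ->
  (forall n t, 0 <= t -> deriv_within (@Rpos R) (u n) t (du n t)) ->
  (forall n, {within @Rpos R, continuous (du n)}) ->
  (forall n t, 0 <= t -> du n t <= c * u n t + e n t) ->
  (forall n t, 0 <= t -> 0 <= e n t <= C) ->
  (forall t, 0 <= t -> e n t @[n --> \oo] --> (0 : R)) ->
  u n T @[n --> \oo] --> uT -> u n 0 @[n --> \oo] --> u0 ->
  uT <= expR (c * T) * u0.
Proof.
move=> T0 c0 hu cdu hle he ce cuT cu0.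
have Tt t : 0 <= t <= T -> 0 <= t by case/andP.
pose h n t := Num.max (du n t - c * u n t) 0.
have h0 n t : 0 <= h n t by rewrite /h le_max lexx orbT.
have hhe n t : 0 <= t -> h n t <= e n t.
  by move=> t0; rewrite /h ge_max; have /andP[-> _] := he n t t0; rewrite andbT lerBlDl hle.
have ch n : {within `[0, T], continuous (h n)}.
  have cu : {within @Rpos R, continuous (u n)}.
    by apply: (deriv_within_continuous (df := du n)) => x; rewrite /Rpos /= in_itv/= andbT; exact: hu.
  have cu' := continuous_subspaceW (@subitv_Rpos T) cu.
  have cdu' := continuous_subspaceW (@subitv_Rpos T) (cdu n).
  apply/subspace_continuousP => t tT.
  apply: (@cvg_comp _ _ _ (fun t => du n t - c * u n t) (fun z => Num.max z 0));
    last exact: continuous_maxr0.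
  apply: cvgB; first by move/subspace_continuousP : cdu'; exact.
  by apply: cvgM; [exact: cvg_cst|move/subspace_continuousP : cu'; exact].
have step n := gronwall_step T0 c0 (hu n) (cdu n) (ch n)
  (fun t _ => h0 n t) (fun t _ => ltac:(by rewrite /h le_max lexx) : du n t - c * u n t <= h n t).
have cint : (\int[mu]_(t in `[0%R, T]) (h n t)%:E)%E @[n --> \oo] --> (0 : \bar R)%E.
  rewrite -[X in _ --> X](integral0 mu `[0%R, T]).
  have C0 : 0 <= C by have /andP[a1 a2] := he 0%N 0 (lexx 0); exact: le_trans a2.
  apply: (@dominated_cvg _ _ _ mu _ (measurable_itv _) (fun n t => (h n t)%:E) _ (cst C%:E)) => //.
  - move=> n; apply/measurable_EFinP.
    by apply: subspace_continuous_measurable_fun => //; exact: ch.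
  - move=> t; rewrite /= in_itv/= => /Tt t0; apply: cvg_EFin; first exact: nearW.
    apply: (@squeeze_cvgr _ _ _ _ (fun=> 0) (fun n => e n t)) => //.
    + by apply: nearW => n; rewrite h0 hhe.
    + exact: cvg_cst.
    + exact: ce.
  - by apply: (bounded_itv_integrable (M := C)) => // x /=; rewrite C0 lexx.
  - move=> n t; rewrite /= in_itv/= => /Tt t0; rewrite lee_fin ger0_norm//.
    by apply: (le_trans (hhe n t t0)); have /andP[] := he n t t0.
have cl : (expR (- (c * T)) * u n T - u n 0)%:E @[n --> \oo] -->
    (expR (- (c * T)) * uT - u0)%:E.
  apply: cvg_EFin; first exact: nearW.
  by apply: cvgB => //; apply: cvgM => //; exact: cvg_cst.
have := lee_cvg_to cl cint.
move=> /(_ _ (nearW _ step)); rewrite lee_fin subr_le0 => H.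
rewrite -(ler_pM2l (expR_gt0 (- (c * T)))) mulrA -expRD addNr expR0 mul1r//.
Qed.

End gronwall.

(** * What the Assumption gives for the extended profile *)

Section kernel_assumption.
Context {R : realType}.
Variables (hphi : R -> R) (b0 eta : R) (k dk : R -> R) (q1 : R).
Hypothesis b0_gt0 : 0 < b0.
Hypothesis eta_ge1 : 1 <= eta.
Hypothesis hphi_bound : forall r, 0 <= r ->
  0 <= hphi r <= b0 * (r `^ eta / (1 + r `^ eta)).
Hypothesis dkP : forall x, 1 <= x <= Num.sqrt 2 ->
  deriv_within `[1, Num.sqrt 2] k x (dk x).
Hypothesis k1 : k 1 = 1.
Hypothesis hphik : forall r a, 0 < r -> 1 < a <= Num.sqrt 2 ->
  hphi (a * r) <= k a * hphi r.
Hypothesis q1_ge0 : 0 <= q1.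
Hypothesis q1P : forall x, 1 <= x <= Num.sqrt 2 -> Num.max (2 * k x * dk x) 0 <= q1.

Lemma max0_ge0 (r : R) : 0 <= Num.max r 0.
Proof. by rewrite le_max lexx orbT. Qed.

Lemma ext0_ge0 r : 0 <= ext0 hphi r.
Proof. by have /andP[] := hphi_bound (max0_ge0 r). Qed.

Lemma ratio_le1 (p : R) : 0 <= p -> p / (1 + p) <= 1.
Proof. by move=> p0; rewrite ler_pdivrMr ?mul1r ?lerDr// ltr_pwDl. Qed.

Lemma ext0_le r : ext0 hphi r <= b0.
Proof.
have /andP[_ h] := hphi_bound (max0_ge0 r); apply: (le_trans h).
by rewrite ler_piMr ?(ltW b0_gt0)// ratio_le1// powR_ge0.
Qed.

(** For [r >= 1] the quotient is at most [1 <= r]; for [r < 1] it is at most the power of [r], which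
    is at most [r] because [eta >= 1]. *)
Lemma ext0_ler r : 0 <= r -> ext0 hphi r <= b0 * r.
Proof.
move=> r0; rewrite ext0E//; have /andP[_ h] := hphi_bound r0; apply: (le_trans h).
have p0 := powR_ge0 r eta.
rewrite ler_wpM2l ?(ltW b0_gt0)//.
have [r1|r1] := leP 1 r; first by rewrite (le_trans (ratio_le1 p0)).
apply: (@le_trans _ _ (r `^ eta)).
  by rewrite ler_piMr// invf_le1 ?lerDl// ltr_pwDl.
move: r0; rewrite le_eqVlt => /predU1P[<-|r0].
  by rewrite powR0// gt_eqF// (lt_le_trans ltr01).
rewrite -[leRHS](powRr1 (ltW r0)).
by apply: ger_powR => //; rewrite r0 ltW.
Qed.

(** Mean value theorem for [k^2] on [[1, a]]: its derivative [2 * k * dk] is the quantity that [q1]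
    bounds. *)
Lemma k_sqr_le a : 1 <= a <= Num.sqrt 2 -> k a ^+ 2 <= 1 + q1 * (a - 1).
Proof.
move=> /andP[a1 a2].
have ck : {within `[1, Num.sqrt 2], continuous k}.
  by apply: (deriv_within_continuous (df := dk)) => x; rewrite /= in_itv/=; exact: dkP.
move: a1; rewrite le_eqVlt => /predU1P[<-|a1].
  by rewrite k1 subrr mulr0 addr0 expr1n.
have sub : `[1, a]%classic `<=` (`[1, Num.sqrt 2]%classic : set R).
  by apply: subset_itvl; rewrite bnd_simp.
have ck' := continuous_subspaceW sub ck.
have dk2 (x : R) : x \in `]1, a[ -> is_derive x 1 (fun y => k y ^+ 2) (2 * k x * dk x).
  rewrite in_itv/= => /andP[x1 xa].
  have x2 : x < Num.sqrt 2 by exact: lt_le_trans xa a2.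
  have dx : is_derive x 1 k (dk x).
    apply: (@deriv_within_is_derive _ `[1, Num.sqrt 2]%classic); last first.
      by apply: dkP; rewrite !ltW.
    have : x \in `]1, Num.sqrt 2[ by rewrite in_itv/= x1.
    move=> /near_in_itvoo; apply: filterS => y.
    by rewrite /= !in_itv/= => /andP[/ltW -> /ltW ->].
  by apply: is_derive_eq; rewrite /GRing.scale/=; ring.
have ck2 : {within `[1, a], continuous (fun y => k y ^+ 2)}.
  apply/subspace_continuousP => t tT.
  apply: (@cvg_comp _ _ _ k (fun z => z ^+ 2)); last exact: exprn_continuous.
  by move/subspace_continuousP : ck'; exact.
have [x] := MVT a1 dk2 ck2; rewrite in_itv/= => /andP[x1 xa].
rewrite k1 expr1n => e.
have -> : k a ^+ 2 = 1 + 2 * k x * dk x * (a - 1) by rewrite -e; ring.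
rewrite lerD2l ler_wpM2r ?subr_ge0 ?(ltW a1)//.
apply: le_trans (q1P (x := x) _); first by rewrite le_max lexx.
by rewrite (ltW x1) (le_trans (ltW xa)).
Qed.

(** The assumption is applied with the ratio [r' / r], which lies in []1, rho]] once [r = r'] and
    [r = 0] are set aside. Since [hphi r >= 0], the bound on the square of [k] is enough, whatever
    the sign of [k]. *)
Lemma ext0_scale rho r r' : 1 <= rho <= Num.sqrt 2 -> 0 <= r -> r <= r' ->
  r' <= rho * r -> ext0 hphi r' <= Num.sqrt (1 + q1 * (rho - 1)) * ext0 hphi r.
Proof.
move=> /andP[rho1 rho2] r0 rr' r'r.
have sq1 : 1 <= Num.sqrt (1 + q1 * (rho - 1)).
  by rewrite -[leLHS]sqrtr1 ler_wsqrtr// lerDl mulr_ge0// subr_ge0.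
have [<-|ne] := eqVneq r r'.
  by rewrite ler_peMl// ext0_ge0.
have rlt : r < r' by rewrite lt_neqAle ne.
move: r0; rewrite le_eqVlt => /predU1P[r0|r0].
  by move: r'r; rewrite -r0 mulr0 leNgt => /negP[]; rewrite r0.
rewrite !ext0E ?(ltW r0)//; last by rewrite (le_trans (ltW r0)).
pose a := r' / r.
have a1 : 1 < a by rewrite ltr_pdivlMr// mul1r.
have arho : a <= rho by rewrite ler_pdivrMr.
have a2 : a <= Num.sqrt 2 by exact: le_trans rho2.
have -> : r' = a * r by rewrite /a divfK// gt_eqF.
have a12 : 1 < a <= Num.sqrt 2 by rewrite a1.
apply: (le_trans (hphik r0 a12)).
have /andP[h0 _] := hphi_bound (ltW r0).
rewrite ler_wpM2r//; apply: (le_trans (ler_norm _)).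
rewrite -sqrtr_sqr ler_wsqrtr//.
apply: (le_trans (k_sqr_le _)); first by rewrite (ltW a1).
by rewrite lerD2l ler_wpM2l// lerD2r.
Qed.

End kernel_assumption.

(** * Conclusion *)

Unset Implicit Arguments.

Theorem theorem1p2 (R : realType) (hphi : R -> R) (b0 eta : R) (k dk : R -> R)
  (q1 : R) (F0 : {measure set R -> \bar R}) (F : R -> {measure set R -> \bar R})
  (N E : R) :
  (* Assumption on the kernel *)
  {within `[0, +oo[, continuous hphi} ->
  0 < b0 -> 1 <= eta ->
  (forall r, 0 <= r -> 0 <= hphi r <= b0 * (r `^ eta / (1 + r `^ eta))) ->
  (forall x, 1 <= x <= Num.sqrt 2 -> deriv_within `[1, Num.sqrt 2] k x (dk x)) ->
  {within `[1, Num.sqrt 2], continuous dk} ->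
  k 1 = 1 ->
  (forall r a, 0 < r -> 1 < a <= Num.sqrt 2 -> hphi (a * r) <= k a * hphi r) ->
  (* q1 = max_{x in [1, sqrt 2]} max{2 k(x) k'(x), 0} *)
  (exists2 x, 1 <= x <= Num.sqrt 2 & q1 = Num.max (2 * k x * dk x) 0) ->
  (forall x, 1 <= x <= Num.sqrt 2 -> Num.max (2 * k x * dk x) 0 <= q1) ->
  (* initial datum *)
  in_B1 F0 -> Nmass F0 = N%:E -> Energy F0 = E%:E -> 0 < N -> 0 < E ->
  cons_mv_solution hphi F0 F ->
  ((forall t, 0 <= t ->
    (F t [set 0%R] <= (expR ((8 `^ (2 + eta) * b0 ^+ 2 * (1 + q1) * N ^+ 2) * t))%:E
                     * F0 [set 0%R])%E) /\
  (F0 [set 0%R] = 0%E -> forall t, 0 <= t -> F t [set 0%R] = 0%E))%type.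
Proof.
move=> chphi b0_gt0 eta1 hb dkP _ k1 hk [x0 _ q1E] q1P F0B F0N _ N0 _.
move=> [F00 [FB [Fcons Feq]]].
have q10 : 0 <= q1 by rewrite q1E max0_ge0.
set c := 8 `^ (2 + eta) * b0 ^+ 2 * (1 + q1) * N ^+ 2.
have cb : 40 * b0 ^+ 2 * (1 + q1) * N ^+ 2 <= c.
  have h8 : 40 <= 8 `^ (2 + eta) :> R.
    apply: (@le_trans _ _ (8 `^ 2%:R)); first by rewrite powR_mulrn//; lra.
    by apply: ler_powR; lra.
  rewrite /c; do 3! (apply: ler_wpM2r; first by rewrite ?sqr_ge0// addr_ge0).
  exact: h8.
have c0 : 0 <= c.
  apply: le_trans cb; apply: mulr_ge0; last exact: sqr_ge0.
  by apply: mulr_ge0; [apply: mulr_ge0 => //; exact: sqr_ge0|exact: addr_ge0].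
have FN t : 0 <= t -> Nmass (F t) = N%:E by move=> t0; rewrite (Fcons t t0).1.
have fin0 t : 0 <= t -> F t [set 0] \is a fin_num.
  by move=> t0; apply: (mass_fin_num (FB t t0) (FN t t0)).
have main t : 0 <= t -> fine (F t [set 0]) <= expR (c * t) * fine (F 0 [set 0]).
  rewrite le_eqVlt => /predU1P[<-|t0].
    by rewrite mulr0 expR0 mul1r.
  have n0 (n : nat) : 0 < n.+1%:R :> R by rewrite ltr0n.
  have hdg n := Feq _ (@testf_C11b R n.+1%:R (ltW (n0 n))).
  have [dg {}hdg] := choice hdg.
  pose u n s := pairing (testf n.+1%:R) (F s).
  (* The first summand is the bound on the quadratic term, the second comes from the cubic terms
     whose first argument is the largest. *)
  pose e n s := 16 * b0 ^+ 2 / n.+1%:R * N ^+ 2 +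
    64 * b0 ^+ 2 * N ^+ 2 * pairing (errf n.+1%:R) (F s).
  have b2 := sqr_ge0 b0; have N2 := sqr_ge0 N.
  have epos n s : 0 <= s -> 0 <= pairing (errf n.+1%:R) (F s) <= N.
    move=> s0; rewrite fine_ge0; last by apply: integral_ge0 => x _; rewrite lee_fin errf_ge0.
    rewrite /=.
    have h : (\int[F s]_(x in @Rpos R) (errf n.+1%:R x)%:E <= N%:E)%E.
      apply: (@le_trans _ _ (\int[F s]_(x in @Rpos R) (cst 1%:E x))%E).
        by apply: le_integral_nonmeas => x _; rewrite lee_fin ?errf_le1.
      rewrite integral_cst; last exact: measurable_itv.
      by rewrite mul1e -[F s _]/(Nmass (F s)) FN.
    rewrite -lee_fin fineK// ge0_fin_numE; first exact: le_lt_trans h (ltry _).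
    by apply: integral_ge0 => x _; rewrite lee_fin errf_ge0.
  have upos n s : 0 <= u n s.
    by apply: fine_ge0; apply: integral_ge0 => x _; rewrite lee_fin testf_ge0.
  have A0 : 0 <= 16 * b0 ^+ 2 * N ^+ 2 by apply: mulr_ge0 => //; exact: mulr_ge0.
  have B0 : 0 <= 64 * b0 ^+ 2 * N ^+ 2 by apply: mulr_ge0 => //; exact: mulr_ge0.
  have cu s : 0 <= s -> u n s @[n --> \oo] --> fine (F s [set 0]).
    move=> s0; rewrite -pairing_mass0.
    apply: (pairing_cvg (FB s s0) (FN s s0)).
    - by move=> n; exact: measurable_testf.
    - by move=> n x xx; rewrite testf_ge0 testf_le1// ltW.
    - by move=> x xx; exact: testf_cvg.
  have invn : (n.+1%:R^-1 : R) @[n --> \oo] --> (0 : R) by exact: cvg_harmonic.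
  apply: (@gronwall_limit R u dg e c (16 * b0 ^+ 2 * N ^+ 2 + 64 * b0 ^+ 2 * N ^+ 2 * N) t) => //.
  - by move=> n s s0; have [h _] := hdg n; exact: h.
  - by move=> n; have [_ [h _]] := hdg n.
  - move=> n s s0; have [_ [_ /(_ s s0)]] := hdg n.
    rewrite collision_rhs_ext0 => h.
    have := collision_rhs_le (continuous_ext0 chphi) (ext0_ge0 hb)
      (ext0_le b0_gt0 hb) (ext0_ler b0_gt0 eta1 hb) q10
      (ext0_scale hb dkP k1 hk q10 q1P) (n0 n) (FB s s0) (FN s s0) h.
    have : 40 * b0 ^+ 2 * (1 + q1) * N ^+ 2 * u n s <= c * u n s by rewrite ler_wpM2r.
    move=> hu hd; apply: (le_trans hd); rewrite -addrA addrCA /e.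
    exact: lerD.
  - move=> n s s0; have /andP[e1 e2] := epos n s s0; rewrite /e.
    have i0 : 0 <= n.+1%:R^-1 :> R by rewrite invr_ge0 ltW.
    have i1 : n.+1%:R^-1 <= 1 :> R by rewrite invf_le1// ler1n.
    have -> : 16 * b0 ^+ 2 / n.+1%:R * N ^+ 2 = 16 * b0 ^+ 2 * N ^+ 2 * n.+1%:R^-1 by rewrite mulrAC.
    apply/andP; split; first by apply: addr_ge0; exact: mulr_ge0.
    by apply: lerD; [rewrite ler_piMr|rewrite ler_wpM2l].
  - move=> s s0; rewrite /e.
    rewrite -[X in _ --> X](_ : 16 * b0 ^+ 2 * 0 * N ^+ 2 + 64 * b0 ^+ 2 * N ^+ 2 * 0 = 0);
      last by rewrite !(mulr0, mul0r) addr0.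
    apply: cvgD.
      by apply: cvgM; [apply: cvgM; [exact: cvg_cst|exact: invn]|exact: cvg_cst].
    apply: cvgM; first exact: cvg_cst.
    (* Writing the limit as the pairing with the zero function lets [pairing_cvg] apply to
       [errf]. *)
    have -> : 0 = pairing (fun=> 0) (F s) :> R by rewrite /pairing integral0.
    apply: (pairing_cvg (FB s s0) (FN s s0)).
    - by move=> n; exact: measurable_errf.
    - by move=> n x _; rewrite errf_ge0 errf_le1.
    - by move=> x _; exact: errf_cvg.
  - exact/cu/ltW.
  - exact: cu.
have mainE t : 0 <= t -> (F t [set 0%R] <= (expR (c * t))%:E * F0 [set 0%R])%E.
  move=> t0; rewrite -F00 -(fineK (fin0 t t0)) -(fineK (fin0 0 (lexx 0))) -EFinM lee_fin.
  exact: main.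
split; first exact: mainE.
move=> F0z t t0; apply/eqP; rewrite eq_le measure_ge0 andbT.
by have := mainE t t0; rewrite F0z mule0.
Qed.
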